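(* Let $(y_i,\mathbf{x}_i^{T},t_i)^{T}$, $i\ge 1$, be i.i.d. observations satisfying the isotonic generalized partly linear model described in the context, with true parameter $\boldsymbol\theta_0=(\boldsymbol\beta_0,\eta_0)$ and nuisance parameter $\kappa_0$, and let $\widehat{\boldsymbol\theta}=(\widehat{\boldsymbol\beta},\widehat\eta)$ be the monotone-spline estimator defined in the context. Let $\mathcal V$ be a neighbourhood of $\kappa_0$ whose closure $\overline{\mathcal V}$ is strictly included in $\mathcal K$. Assume: (C0) $\widehat\kappa\to\kappa_0$ almost surely. (C1) $\rho(y,u,a)$ and $w(\cdot)$ are non-negative bounded functions and $\rho(y,u,a)$ is continuous. Moreover, with $L^{\star}(\boldsymbol\beta,\boldsymbol\lambda,a)=L(\boldsymbol\beta,\sum_{j=1}^{k_n}\lambda_jB_j,a)$, for every $\epsilon>0$ there exists $\delta>0$ (not depending on $n$) such that for all $a_1,a_2\in\overline{\mathcal V}$, $$|a_1-a_2|<\delta\ \Rightarrow\ \sup_{\boldsymbol\beta\in\mathbb R^p,\ \boldsymbol\lambda\in\mathcal L_{k_n}}|L^{\star}(\boldsymbol\beta,\boldsymbol\lambda,a_1)-L^{\star}(\boldsymbol\beta,\boldsymbol\lambda,a_2)|<\epsilon .$$ (C2) $\eta_0$ is nondecreasing and, for some integer $r\ge1$ and constants $C_1,C_2$, $\eta_0\in\mathcal H_r=\{g\in C^r[0,1]:\|g^{(j)}\|_\infty\le C_1,\ 0\le j\le r,\ \text{and } |g^{(r)}(z_1)-g^{(r)}(z_2)|\le C_2|z_1-z_2|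 \text{ for all } z_1,z_2\in[0,1]\}$. (C3) The maximum spacing of the knots is of order $O(n^{-\nu})$, $0<\nu<1/2$, and the ratio of maximum and minimum spacings of the knots is uniformly bounded (in $n$). (C4) The class $\mathcal F_n=\{f(y,\mathbf x,t)=\rho(y,\mathbf x^{T}\boldsymbol\beta+\boldsymbol\lambda^{T}\mathbf B(t),a)\,w(\mathbf x):\ \boldsymbol\beta\in\mathbb R^p,\ \boldsymbol\lambda\in\mathcal L_{k_n},\ a\in\mathcal V\}$ satisfies, for any $0<\epsilon<1$, $\log N(\epsilon,\mathcal F_n,L_1(P_n))=O_{\mathbb P}(1)\,k_n\log(1/\epsilon)$. Assume further that for every $\epsilon>0$, $\inf_{\boldsymbol\theta\in\mathcal A_\epsilon}L(\boldsymbol\theta,\kappa_0)>L(\boldsymbol\theta_0,\kappa_0)$, where $\mathcal A_\epsilon=\{\boldsymbol\theta=(\boldsymbol\beta,g):\boldsymbol\beta\in\mathbb R^p,\ g\in\mathcal G\cap\mathcal F,\ \pi(\boldsymbol\theta,\boldsymbol\theta_0)>\epsilon\}$, and that $k_n=O(n^{\nu})$ with $1/(2r+2)<\nu<1/(2r)$. Then $\pi(\boldsymbol\theta_0,\widehat{\boldsymbol\theta})\to0$ almost surely as $n\to\infty$.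
   Context: Model: $y_i\in\mathbb R$, $\mathbf x_i\in\mathbb R^p$, $t_i\in[0,1]$; conditionally on $(\mathbf x_i,t_i)$, $y_i\sim F(\cdot,\mu_i,\kappa_0)$ with $\mu_i=\mathbb E(y_i|(\mathbf x_i,t_i))=H(\mathbf x_i^{T}\boldsymbol\beta_0+\eta_0(t_i))$ and $\mathrm{Var}(y_i|(\mathbf x_i,t_i))=A^2(\kappa_0)V^2(\mu_i)$, where $A,V$ are known functions, $H^{-1}$ is a known link function, $\boldsymbol\beta_0\in\mathbb R^p$ is unknown, $\eta_0:[0,1]\to\mathbb R$ is an unknown continuous nondecreasing function, and $\kappa_0\in\mathcal K$ with $\mathcal K\subset\mathbb R$ open. Objective functions: $w:\mathbb R^p\to\mathbb R$ is a weight function and $\rho(y,u,a)$ ($y,u\in\mathbb R$, $a\in\mathcal K$) a real-valued loss function. Put $$L_n(\boldsymbol\beta,g,a)=\frac1n\sum_{i=1}^n\rho(y_i,\mathbf x_i^{T}\boldsymbol\beta+g(t_i),a)w(\mathbf x_i),\qquad L(\boldsymbol\beta,g,a)=\mathbb E\,\rho(y_1,\mathbf x_1^{T}\boldsymbol\beta+g(t_1),a)w(\mathbf x_1),$$ and write $L(\boldsymbol\theta,a)=L(\boldsymbol\beta,g,a)$ for $\boldsymbol\theta=(\boldsymbol\beta,g)$. Splines: $\ell>1$ is a fixed order; $\mathcal T_n$ is a sequence of knots $0=\tau_1=\dots=\tau_\ell<\tau_{\ell+1}<\dots<\tau_{m_n+\ell+1}=\dots=\tau_{m_n+2\ell}=1$,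 partitioning $[0,1]$ into $m_n+1$ subintervals; $k_n=m_n+\ell$; $B_1,\dots,B_{k_n}$ are the B-spline basis functions of order $\ell$ with knots $\mathcal T_n$ and $\mathbf B(t)=(B_1(t),\dots,B_{k_n}(t))^{T}$. $\mathcal L_{k_n}=\{\boldsymbol\lambda\in\mathbb R^{k_n}:\lambda_1\le\dots\le\lambda_{k_n}\}$. Estimator: $\widehat\kappa$ is an estimator of $\kappa_0$ and $(\widehat{\boldsymbol\beta},\widehat{\boldsymbol\lambda})$ minimizes $L_n(\boldsymbol\beta,\sum_{j=1}^{k_n}\lambda_jB_j,\widehat\kappa)$ over $\boldsymbol\beta\in\mathbb R^p$, $\boldsymbol\lambda\in\mathcal L_{k_n}$; $\widehat\eta=\sum_{j=1}^{k_n}\widehat\lambda_jB_j$ and $\widehat{\boldsymbol\theta}=(\widehat{\boldsymbol\beta},\widehat\eta)$. Standing assumption (Fisher-consistency): with $\mathcal G=\{g: g\text{ is a monotonically nondecreasing function on }[0,1]\}$, $L(\boldsymbol\beta_0,\eta_0,\kappa_0)<L(\boldsymbol\beta,g,\kappa_0)$ for every $(\boldsymbol\beta,g)\in\mathbb R^p\times\mathcal G$ with $(\boldsymbol\beta,g)\ne(\boldsymbol\beta_0,\eta_0)$. Metric: $\mathcal F$ is the space of continuous functions $g:[0,1]\to\mathbb R$, equipped with a norm $\|\cdot\|_{\mathcal F}$ such as $\|f\|_2=(\mathbb E f^2(t_1))^{1/2}$ or $\|f\|_\infty=\sup_{t\in[0,1]}|f(t)|$; $\pi^2(\boldsymbol\theta_1,\boldsymbol\theta_2)=\|\boldsymbol\beta_1-\boldsymbol\beta_2\|^2+\|\eta_1-\eta_2\|_{\mathcal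 F}^2$ for $\boldsymbol\theta_j=(\boldsymbol\beta_j,\eta_j)$, with $\|\cdot\|$ the Euclidean norm. $P_n$ is the empirical measure of $(y_i,\mathbf x_i,t_i)$, $1\le i\le n$; $N(\epsilon,\mathcal F_n,L_1(P_n))$ is the $\epsilon$-covering number of $\mathcal F_n$ in the $L_1(P_n)$ distance. *)

(* Defs.v *)
From HB Require Import structures.
From mathcomp Require Import all_boot all_order all_algebra.
From mathcomp Require Import all_classical all_reals all_analysis.

Set Implicit Arguments.
Unset Strict Implicit.
Unset Printing Implicit Defensive.
Import Order.TTheory GRing.Theory Num.Theory.
Import numFieldNormedType.Exports.
Local Open Scope classical_set_scope.
Local Open Scope ring_scope.

(* An observation z = (y, x, t). *)
Notation obs R p :=
  (measurableTypeR R * p.-tuple (measurableTypeR R) * measurableTypeR R)%type.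

Definition obs_y (R : realType) (p : nat) (z : obs R p) : R := z.1.1.
Definition obs_x (R : realType) (p : nat) (z : obs R p) : p.-tuple R := z.1.2.
Definition obs_t (R : realType) (p : nat) (z : obs R p) : R := z.2.

Definition dot (R : realType) (p : nat) (x : p.-tuple R) (b : 'rV[R]_p) : R :=
  \sum_(j < p) tnth x j * b ord0 j.

(* The library norm on matrices is the sup norm. *)
Definition euclidean_norm (R : realType) (p : nat) (b : 'rV[R]_p) : R :=
  Num.sqrt (\sum_(j < p) b ord0 j ^+ 2).

(* Functions on [0, 1] are represented by total functions R -> R of which only
   the values on [0, 1] matter. *)
Definition nondecreasing01 (R : realType) (g : R -> R) : Prop :=
  {in `[0, 1] &, {homo g : s t / s <= t}}.

Definition continuous01 (R : realType) (g : R -> R) : Prop :=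
  {within `[0, 1], continuous g}.

Definition eq01 (R : realType) (f g : R -> R) : Prop :=
  {in `[0, 1], f =1 g}.

(* Definiteness is not demanded, so that both the sup norm and
   (E f^2(t_1))^(1/2) are covered whatever the law of t_1: the latter is
   definite on C[0, 1] only if that law has full support. *)
Record norm_on_C01 (R : realType) (N : (R -> R) -> R) : Prop := NormOnC01 {
  normC01_ext : forall f g, eq01 f g -> N f = N g ;
  normC01_ge0 : forall f, continuous01 f -> 0 <= N f ;
  normC01_scale : forall (c : R) f, continuous01 f ->
    N (fun t => c * f t) = `|c| * N f ;
  normC01_triangle : forall f g, continuous01 f -> continuous01 g ->
    N (fun t => f t + g t) <= N f + N g }.

Definition pi_dist (R : realType) (p : nat) (N : (R -> R) -> R)
    (th1 th2 : 'rV[R]_p * (R -> R)) : R :=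
  Num.sqrt (euclidean_norm (th1.1 - th2.1) ^+ 2
            + N (fun t => th1.2 t - th2.2 t) ^+ 2).

(* f' is the derivative of f on [0, 1], one-sided at the end points. *)
Definition is_deriv01 (R : realType) (f f' : R -> R) : Prop :=
  forall t, t \in `[0, 1] ->
    (fun s => (f s - f t) / (s - t)) @ within `[0, 1] t^' --> f' t.

Definition holder_class (R : realType) (r : nat) (C1 C2 : R) (g : R -> R) :
    Prop :=
  exists D : nat -> R -> R,
    [/\ eq01 (D 0%N) g,
        forall j, (j < r)%N -> is_deriv01 (D j) (D j.+1),
        continuous01 (D r),
        forall j, (j <= r)%N -> forall t, t \in `[0, 1] -> `|D j t| <= C1 &
        forall z1 z2, z1 \in `[0, 1] -> z2 \in `[0, 1] ->
          `|D r z1 - D r z2| <= C2 * `|z1 - z2|].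

(* Knots are indexed from 0: tau j is the knot tau_(j+1) of the usual
   1-based numbering. *)
Record knot_seq (R : realType) (l m : nat) (tau : nat -> R) : Prop := KnotSeq {
  knot_left : forall j, (j < l)%N -> tau j = 0 ;
  knot_lt : forall j, (l.-1 <= j < m + l)%N -> tau j < tau j.+1 ;
  knot_right : forall j, (m + l <= j < m + l.*2)%N -> tau j = 1 }.

Definition spacing (R : realType) (l : nat) (tau : nat -> R) (j : nat) : R :=
  tau (l.-1 + j).+1 - tau (l.-1 + j)%N.

Definition max_spacing (R : realType) (l m : nat) (tau : nat -> R) : R :=
  \big[Num.max/0]_(j < m.+1) spacing l tau j.

(* The spacings are at most 1 because the knots span [0, 1]. *)
Definition min_spacing (R : realType) (l m : nat) (tau : nat -> R) : R :=
  \big[Num.min/1]_(j < m.+1) spacing l tau j.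

(* Cox-de Boor recursion on the degree d = order - 1, with 0 / 0 = 0, which is
   the library's convention for division.  The last nondegenerate knot interval
   is closed on the right, so that the basis sums to 1 at t = 1 too. *)
Fixpoint bspline_deg (R : realType) (tau : nat -> R) (d j : nat) (t : R) : R :=
  match d with
  | 0 => (((tau j <= t) && (t < tau j.+1))
          || [&& tau j < tau j.+1, tau j.+1 == 1 & t == 1])%:R
  | d'.+1 =>
      (t - tau j) / (tau (j + d'.+1)%N - tau j) * bspline_deg tau d' j t
      + (tau (j + d'.+2)%N - t) / (tau (j + d'.+2)%N - tau j.+1)
        * bspline_deg tau d' j.+1 t
  end.

Definition bspline (R : realType) (l : nat) (tau : nat -> R) (j : nat) :
    R -> R :=
  bspline_deg tau l.-1 j.

Definition spline (R : realType) (l k : nat) (tau : nat -> R)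
    (lam : 'rV[R]_k) (t : R) : R :=
  \sum_(j < k) lam ord0 j * bspline l tau j t.

Definition monotone_coef (R : realType) (k : nat) : set 'rV[R]_k :=
  [set lam | forall i j : 'I_k, (i <= j)%N -> lam ord0 i <= lam ord0 j].

Definition loss (R : realType) (p : nat) (rho : R -> R -> R -> R)
    (w : p.-tuple R -> R) (b : 'rV[R]_p) (g : R -> R) (a : R) (z : obs R p) :
    R :=
  rho (obs_y z) (dot (obs_x z) b + g (obs_t z)) a * w (obs_x z).

Definition emp_risk (R : realType) (p : nat) (rho : R -> R -> R -> R)
    (w : p.-tuple R -> R) (n : nat) (z : nat -> obs R p)
    (b : 'rV[R]_p) (g : R -> R) (a : R) : R :=
  n%:R^-1 * \sum_(i < n) loss rho w b g a (z i).

Definition risk (R : realType) (p : nat) (d : measure_display)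
    (T : measurableType d) (P : probability T R) (Z : T -> obs R p)
    (rho : R -> R -> R -> R) (w : p.-tuple R -> R)
    (b : 'rV[R]_p) (g : R -> R) (a : R) : \bar R :=
  'E_P[(fun omega => loss rho w b g a (Z omega))].

Definition iid (R : realType) (d d' : measure_display) (T : measurableType d)
    (S : measurableType d') (P : probability T R) (Z : nat -> T -> S) : Prop :=
  [/\ forall i, measurable_fun setT (Z i),
      forall i (A : set S), measurable A ->
        P (Z i @^-1` A) = P (Z 0%N @^-1` A) &
      forall (J : seq nat) (A : nat -> set S), uniq J ->
        (forall i, measurable (A i)) ->
        P (\bigcap_(i in [set` J]) Z i @^-1` A i)
        = (\prod_(i <- J) P (Z i @^-1` A i))%E].

Definition cond_mean (R : realType) (p : nat) (H : R -> R) (b0 : 'rV[R]_p)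
    (eta0 : R -> R) (z : obs R p) : R :=
  H (dot (obs_x z) b0 + eta0 (obs_t z)).

(* F a mu is the law F(., mu, a).  The first clause says that F(., mu, kappa0)
   is a regular conditional distribution of y given (x, t); the other two give
   the mean and the variance of this conditional distribution. *)
Record gplm (R : realType) (p : nat) (d : measure_display)
    (T : measurableType d) (P : probability T R) (Z : T -> obs R p)
    (F : R -> R.-pker (measurableTypeR R) ~> (measurableTypeR R))
    (H A V : R -> R) (b0 : 'rV[R]_p) (eta0 : R -> R) (kappa0 : R) : Prop :=
  Gplm {
  gplm_t01 : forall omega, obs_t (Z omega) \in `[0, 1] ;
  gplm_law : forall (B : set (measurableTypeR R))
      (C : set (p.-tuple (measurableTypeR R) * measurableTypeR R)),
    measurable B -> measurable C ->
    let E := [set omega | C (obs_x (Z omega), obs_t (Z omega))] in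
    P ([set omega | B (obs_y (Z omega))] `&` E)
    = (\int[P]_(omega in E) F kappa0 (cond_mean H b0 eta0 (Z omega)) B)%E ;
  gplm_mean : {ae P, forall omega,
    let mu := cond_mean H b0 eta0 (Z omega) in
    (F kappa0 mu).-integrable setT (fun y => y%:E) /\
    (\int[F kappa0 mu]_y y%:E = mu%:E)%E} ;
  gplm_var : {ae P, forall omega,
    let mu := cond_mean H b0 eta0 (Z omega) in
    (\int[F kappa0 mu]_y ((y - mu) ^+ 2)%:E
     = (A kappa0 ^+ 2 * V mu ^+ 2)%:E)%E} }.

(* Centres need not belong to the class. *)
Definition covering_number (R : realType) (p : nat) (n : nat)
    (z : nat -> obs R p) (eps : R) (FF : set (obs R p -> R)) : \bar R :=
  ereal_inf [set (N%:R%:E : \bar R) | N in [set N : nat |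
    exists c : 'I_N -> obs R p -> R, forall f, FF f ->
      exists j, n%:R^-1 * \sum_(i < n) `|f (z i) - c j (z i)| < eps]].

(* X_n = O_P(1) r_n.  The exceptional event is only required to be contained in
   a small measurable one, since X_n may fail to be measurable. *)
Definition bounded_in_probability (R : realType) (d : measure_display) (T : measurableType d)
    (P : probability T R) (X : nat -> T -> \bar R) (r : nat -> R) : Prop :=
  forall delta : R, 0 < delta ->
  exists M : R, \forall n \near \oo,
  exists B : set T, [/\ measurable B, (P B < delta%:E)%E &
    [set omega | (M * r n)%:E < `|X n omega|]%E `<=` B].

(* Main.v *)
Require Import Defs.
From HB Require Import structures.
From mathcomp Require Import all_boot all_order all_algebra.
From mathcomp Require Import all_classical all_reals all_analysis.
From mathcomp Require Import measurable_realfun ring lra.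

Set Implicit Arguments.
Unset Strict Implicit.
Unset Printing Implicit Defensive.
Import Order.TTheory GRing.Theory Num.Theory.
Import numFieldNormedType.Exports.
Local Open Scope classical_set_scope.
Local Open Scope ring_scope.

(** Classical consistency of minimum-contrast estimators: outside every
    neighbourhood of theta0 the risk exceeds its minimum by a margin, so it is
    enough that the risk of the estimator tends to the minimal risk.  Let
    S_n be the supremum over the spline parameters, and over a close to kappa0,
    of the distance between the empirical risk and the risk.  If g_n is the
    monotone spline whose coefficients are the values of eta0 at the knots,
    minimality of the empirical risk at the estimator gives
    L (thetahat, kappahat) <= L (beta0, g_n, kappahat) + 2 S_n.
    By equicontinuity in the nuisance parameter kappahat may be replaced by
    kappa0, and L (beta0, g_n, kappa0) tends to the minimal risk by bounded
    convergence, because g_n tends to eta0 pointwise.  Splines with monotone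
    coefficients are continuous and nondecreasing (spline_continuous01,
    spline_monotone), so the margin applies to the estimator.

    It remains to show that S_n tends to 0 almost surely
    (ae_uniform_empirical_risk).  The covering numbers are only controlled in
    probability, and the classes vary with n, so neither a Borel-Cantelli
    argument on the covering numbers nor a reverse martingale is available.
    Instead, the bound in probability is enough to make the expectation of S_n
    tend to 0: symmetrize (expect_symmetrize), then bound the Rademacher average
    given the sample by the covering number, which is subexponential since
    the number of parameters is o(n) (expect_total_deviation_le,
    covering_subexponential).  On the other hand changing one observation
    changes S_n by O(1/n), so that by the bounded differences inequality
    (bounded_differences_tail) S_n exceeds its expectation by a fixed amount
    with exponentially small probability, and the Borel-Cantelli lemma applies
    (ae_uniform_law).

    All these bounds are uniform over finite subfamilies; they extend to countable
    ones by monotone limits, and to the whole class by continuity of the loss in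
    its parameters, since rational parameters are dense. *)

(** * Bounded measurable functions and their integrals *)

Definition bounded_measurable (R : realType) (d : measure_display)
    (X : measurableType d) (f : X -> R) : Prop :=
  measurable_fun setT f /\ exists M, forall x, `|f x| <= M.

Section bounded_measurable.
Context (R : realType) (d : measure_display) (X : measurableType d).
Implicit Types f g : X -> R.

Lemma bounded_measurable_cst (c : R) : bounded_measurable (fun _ : X => c).
Proof. by split; [exact: measurable_cst|exists `|c|]. Qed.

Lemma bounded_measurableD f g : bounded_measurable f -> bounded_measurable g ->
  bounded_measurable (fun x => f x + g x).
Proof.
move=> [mf [M fM]] [mg [N gN]]; split; first exact: measurable_funD.
by exists (M + N) => x; rewrite (le_trans (ler_normD _ _))// lerD.
Qed.

Lemma bounded_measurableN f : bounded_measurable f ->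
  bounded_measurable (fun x => - f x).
Proof.
move=> [mf [M fM]]; split; first exact: measurableT_comp.
by exists M => x; rewrite normrN.
Qed.

Lemma bounded_measurableM f g : bounded_measurable f -> bounded_measurable g ->
  bounded_measurable (fun x => f x * g x).
Proof.
move=> [mf [M fM]] [mg [N gN]]; split; first exact: measurable_funM.
by exists (M * N) => x; rewrite normrM ler_pM.
Qed.

Lemma bounded_measurable_norm f : bounded_measurable f ->
  bounded_measurable (fun x => `|f x|).
Proof.
move=> [mf [M fM]]; split; first exact: measurableT_comp.
by exists M => x; rewrite normr_id.
Qed.

Lemma bounded_measurable_max f g : bounded_measurable f ->
  bounded_measurable g -> bounded_measurable (fun x => Num.max (f x) (g x)).
Proof.
move=> [mf [M fM]] [mg [N gN]]; split; first exact: measurable_maxr.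
exists (M + N) => x; have M0 := le_trans (normr_ge0 _) (fM x).
have N0 := le_trans (normr_ge0 _) (gN x).
rewrite /Num.max; case: ifP => _.
  by rewrite (le_trans (gN x))// lerDr.
by rewrite (le_trans (fM x))// lerDl.
Qed.

Lemma bounded_measurable_expR f : bounded_measurable f ->
  bounded_measurable (fun x => expR (f x)).
Proof.
move=> [mf [M fM]]; split; first exact: measurableT_comp.
exists (expR M) => x; rewrite ger0_norm ?expR_ge0// ler_expR.
by rewrite (le_trans (ler_norm _)).
Qed.

Lemma bounded_measurable_sum (I : Type) (r : seq I) (f : I -> X -> R) :
  (forall i, bounded_measurable (f i)) ->
  bounded_measurable (fun x => \sum_(i <- r) f i x).
Proof.
move=> bf; elim: r => [|i r IHr].
  by under eq_fun do rewrite big_nil; exact: bounded_measurable_cst.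
by under eq_fun do rewrite big_cons; exact: bounded_measurableD.
Qed.

Lemma bounded_measurable_bigmax (I : Type) (r : seq I) (f : I -> X -> R) :
  (forall i, bounded_measurable (f i)) ->
  bounded_measurable (fun x => \big[Num.max/0]_(i <- r) f i x).
Proof.
move=> bf; elim: r => [|i r IHr].
  by under eq_fun do rewrite big_nil; exact: bounded_measurable_cst.
by under eq_fun do rewrite big_cons; exact: bounded_measurable_max.
Qed.

Lemma bounded_measurable_comp (d' : measure_display) (Y : measurableType d')
    (h : Y -> X) f :
  bounded_measurable f -> measurable_fun setT h ->
  bounded_measurable (fun y => f (h y)).
Proof.
by move=> [mf [M fM]] mh; split; [exact: measurableT_comp|exists M].
Qed.

Variable P : probability X R.

Lemma bounded_measurable_integrable f :
  bounded_measurable f -> P.-integrable setT (EFin \o f).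
Proof.
move=> [mf [M fM]]; apply: measurable_bounded_integrable => //.
  by rewrite (@le_lt_trans _ _ 1%E) ?ltry// probability_le1.
exists M; split; first exact: num_real.
by move=> N MN x _ /=; rewrite (le_trans (fM x))// ltW.
Qed.

Lemma bounded_measurable_integralE f : bounded_measurable f ->
  (\int[P]_x (f x)%:E)%E = (\int[P]_x f x)%:E.
Proof.
move=> bf; rewrite fineK//; apply: integrable_fin_num => //.
exact: bounded_measurable_integrable.
Qed.

Lemma expectD f g : bounded_measurable f -> bounded_measurable g ->
  \int[P]_x (f x + g x) = \int[P]_x f x + \int[P]_x g x.
Proof.
by move=> bf bg; rewrite RintegralD//; exact: bounded_measurable_integrable.
Qed.

Lemma expectZ (c : R) f : bounded_measurable f ->
  \int[P]_x (c * f x) = c * \int[P]_x f x.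
Proof.
by move=> bf; rewrite RintegralZl//; exact: bounded_measurable_integrable.
Qed.

Lemma expect_cst (c : R) : \int[P]_x c = c.
Proof.
rewrite Rintegral_cst//.
by rewrite (congr1 fine (probability_setT P)) mulr1.
Qed.

Lemma expectN f : bounded_measurable f ->
  \int[P]_x (- f x) = - \int[P]_x f x.
Proof.
move=> bf; rewrite -mulN1r -expectZ//.
by apply: eq_Rintegral => x _; rewrite mulN1r.
Qed.

Lemma le_expect f g : bounded_measurable f -> bounded_measurable g ->
  (forall x, f x <= g x) -> \int[P]_x f x <= \int[P]_x g x.
Proof.
move=> bf bg fg.
by apply: le_Rintegral => //; exact: bounded_measurable_integrable.
Qed.

Lemma expect_ge (a : R) f : bounded_measurable f -> (forall x, a <= f x) ->
  a <= \int[P]_x f x.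
Proof.
move=> bf af; rewrite -[leLHS]expect_cst; apply: le_expect => //.
exact: bounded_measurable_cst.
Qed.

Lemma expect_le (a : R) f : bounded_measurable f -> (forall x, f x <= a) ->
  \int[P]_x f x <= a.
Proof.
move=> bf af; rewrite -[leRHS]expect_cst; apply: le_expect => //.
exact: bounded_measurable_cst.
Qed.

Lemma norm_expect_le f : bounded_measurable f ->
  `|\int[P]_x f x| <= \int[P]_x `|f x|.
Proof.
move=> bf; apply: le_normr_Rintegral => //.
exact: bounded_measurable_integrable.
Qed.

End bounded_measurable.

(** * Independence *)

Section fubini_bounded.
Context (R : realType) (d1 d2 : measure_display).
Context (X : measurableType d1) (Y : measurableType d2).
Variables (P : probability X R) (Q : probability Y R) (F : X * Y -> R).
Hypothesis bF : bounded_measurable F.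

Let PQ := (P \x Q)%E.

Let intF : PQ.-integrable setT (EFin \o F).
Proof.
have [mF [M FM]] := bF; apply: measurable_bounded_integrable => //.
  rewrite -setXTT /= product_measure1E// (_ : (_ * _)%E = 1%E) ?ltry//.
  by rewrite -[RHS]mule1; congr (_ * _)%E; exact: probability_setT.
exists M; split; first exact: num_real.
by move=> N MN x _ /=; rewrite (le_trans (FM x))// ltW.
Qed.

Let bFl x : bounded_measurable (fun y => F (x, y)).
Proof. exact: bounded_measurable_comp bF (measurable_pair1 _). Qed.

Let bFr y : bounded_measurable (fun x => F (x, y)).
Proof. exact: bounded_measurable_comp bF (measurable_pair2 _). Qed.

Lemma bounded_measurable_partial : bounded_measurable (fun x => \int[Q]_y F (x, y)).
Proof.
split.
  apply/measurable_EFinP; have := measurable_fubini_F intF.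
  by apply: eq_measurable_fun => x _; rewrite /= -bounded_measurable_integralE.
have [_ [M FM]] := bF; exists M => x.
apply: le_trans (norm_expect_le _ (bFl x)) _.
by apply: expect_le => //; exact: bounded_measurable_norm.
Qed.

Lemma fubini_bounded : \int[P]_x \int[Q]_y F (x, y) = fine (\int[PQ]_z (F z)%:E)%E.
Proof.
rewrite -(integral12_prod_meas1 intF); congr fine; apply: eq_integral => x _.
by rewrite -bounded_measurable_integralE.
Qed.

Lemma fubini_bounded_swap :
  \int[P]_x \int[Q]_y F (x, y) = \int[Q]_y \int[P]_x F (x, y).
Proof.
have /(congr1 fine) := Fubini intF.
congr (_ = _); congr fine; apply: eq_integral => x _ /=;
  by rewrite -bounded_measurable_integralE.
Qed.

End fubini_bounded.

Section independence.
Context (R : realType) (d d' : measure_display).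
Context (T : measurableType d) (S : measurableType d').
Variables (P : probability T R) (Z : nat -> T -> S).
Hypothesis iidZ : iid P Z.

Definition sample (s : seq nat) (omega : T) : seq S := [seq Z i omega | i <- s].

Definition sample_tuple (s : seq nat) (omega : T) : (size s).-tuple S :=
  [tuple of [seq Z i omega | i <- in_tuple s]].

Lemma measurable_sample_tuple s : measurable_fun setT (sample_tuple s).
Proof.
have [mZ _ _] := iidZ.
apply/measurable_fun_tnthP => i.
rewrite (_ : _ \o _ = Z (tnth (in_tuple s) i)); first exact: mZ.
by apply/funext => omega; rewrite /= tnth_map.
Qed.

Let box n : set (set (n.-tuple S)) :=
  [set B | exists2 A : 'I_n -> set S, (forall i, measurable (A i)) &
    B = [set w | forall i, A i (tnth w i)]].

Let boxI n : setI_closed (@box n).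
Proof.
move=> _ _ [A mA ->] [B mB ->]; exists (fun i => A i `&` B i).
  by move=> i; exact: measurableI.
apply/seteqP; split => [w [Aw Bw] i|w ABw]; first by split.
by split => i; have [] := ABw i.
Qed.

Let box_setT n : @box n setT.
Proof. by exists (fun=> setT) => //; apply/seteqP; split. Qed.

Let box_generates n : @measurable _ (n.-tuple S) = <<s @box n >>.
Proof.
apply/seteqP; split.
  apply: smallest_sub; first exact: smallest_sigma_algebra.
  move=> B; rewrite -bigcup_seq /= => -[i _ [A mA <-]].
  apply: sub_sigma_algebra; rewrite /= setTI.
  exists (fun j => if j == i then A else setT) => [j|]; first by case: ifP.
  apply/seteqP; split => w /=; first by move=> Aw j; case: eqP => [->|].
  by move=> /(_ i); rewrite eqxx.
apply: smallest_sub; first exact: sigma_algebra_measurable.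
move=> _ [A mA ->].
rewrite (_ : mkset _ = \big[setI/setT]_i ((@tnth n S ^~ i) @^-1` A i)).
  apply: bigsetI_measurable => i _.
  by rewrite -[_ @^-1` _]setTI; exact: measurable_tnth.
by rewrite -bigcap_seq; apply/seteqP; split => w /= Aw i; [move=> _|];
  apply: Aw; rewrite /= ?mem_index_enum.
Qed.

Let indep_sets k s A B : uniq (k :: s) -> measurable A -> measurable B ->
  P (Z k @^-1` A `&` sample_tuple s @^-1` B)
  = (P (Z k @^-1` A) * P (sample_tuple s @^-1` B))%E.
Proof.
move=> us mA mB; have [mZ _ indZ] := iidZ.
have mZA : measurable (Z k @^-1` A) by rewrite -[_ @^-1` _]setTI; exact: mZ.
pose W : {mfun T >-> (size s).-tuple S} :=
  HB.pack (sample_tuple s) (isMeasurableFun.Build _ _ _ _ _ (@measurable_sample_tuple s)).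
pose c := NngNum (fine_ge0 (measure_ge0 P (Z k @^-1` A))).
have PE : (c%:num)%:E = P (Z k @^-1` A).
  by rewrite /= fineK// fin_num_measure.
pose m1 := measure_function_pushforward__canonical__measure_function_Measure
  (mrestr P mZA) (@measurable_sample_tuple s).
pose m2 := mscale c (distribution P W).
have m12 B' : box B' -> m1 B' = m2 B'.
  move=> [C mC ->].
  change (P (sample_tuple s @^-1` [set w | forall i, C i (tnth w i)] `&`
      Z k @^-1` A) =
    (c%:num)%:E * P (sample_tuple s @^-1` [set w | forall i, C i (tnth w i)]))%E.
  rewrite PE setIC.
  pose D i := if i == k then A else
    if insub (index i s) is Some j then C j else setT.
  have mD i : measurable (D i) by rewrite /D; case: ifP => // _; case: insubP.
  move: us; rewrite /= => /andP[ks us].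
  have Ds i j : i = tnth (in_tuple s) j -> D i = C j.
    move=> ij; have si : i \in s by rewrite ij mem_tnth.
    rewrite /D; case: eqP => [ik|_]; first by rewrite -ik si in ks.
    case: insubP => [j' _ jj'|]; last by rewrite index_mem si.
    congr C; apply/val_inj; rewrite /= jj' ij (tnth_nth 0%N) /= index_uniq//.
  have preW : sample_tuple s @^-1` [set w | forall i, C i (tnth w i)] =
      \bigcap_(i in [set` s]) Z i @^-1` D i.
    apply/seteqP; split => omega /=.
      move=> CW i /= si; have [j ij] : exists j, i = tnth (in_tuple s) j.
        exact/tnthP.
      by rewrite (Ds _ _ ij) ij; have := CW j; rewrite tnth_map.
    move=> DZ i; rewrite tnth_map -(Ds (tnth (in_tuple s) i) i)//.
    by apply: DZ; rewrite /= mem_tnth.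
  have preWk : Z k @^-1` A `&` sample_tuple s @^-1` [set w | forall i, C i (tnth w i)] =
      \bigcap_(i in [set` k :: s]) Z i @^-1` D i.
    rewrite preW; apply/seteqP; split => omega /=.
      move=> [Ak Ds'] i /=; rewrite inE => /predU1P[->|]; last exact: Ds'.
      by rewrite /D eqxx.
    move=> DZ; split; first by have := DZ k; rewrite /= mem_head /D eqxx; apply.
    by move=> i /= si; apply: DZ; rewrite /= inE si orbT.
  have Dk : D k = A by rewrite /D eqxx.
  by rewrite preWk preW !indZ//= ?big_cons ?Dk// ks.
have coverT : \bigcup_(_ in [set: nat]) [set: (size s).-tuple S] = setT.
  by rewrite bigcup_const//; exists 0%N.
have m1_fin (_ : nat) : (m1 setT < +oo)%E.
  change (P (sample_tuple s @^-1` setT `&` Z k @^-1` A) < +oo)%E.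
  by rewrite preimage_setT setTI (le_lt_trans (probability_le1 P mZA))// ltry.
have := @measure_unique _ R _ (@box (size s)) (fun=> setT)
  (@box_generates _) (@boxI _) (fun=> @box_setT _) coverT m1 m2 m12 m1_fin B mB.
by rewrite setIC -PE.
Qed.

(** The joint law of an observation and of other ones agrees with the product of
    the two laws on boxes, which generate; Fubini's theorem then separates the
    two integrations. *)
Lemma expect_sample_cons k s (Phi : S * (size s).-tuple S -> R) :
  uniq (k :: s) -> bounded_measurable Phi ->
  \int[P]_omega Phi (Z k omega, sample_tuple s omega) =
  \int[P]_omega' \int[P]_omega Phi (Z k omega', sample_tuple s omega).
Proof.
move=> us bPhi; have [mZ _ _] := iidZ.
pose X : {mfun T >-> S} := HB.pack (Z k) (isMeasurableFun.Build _ _ _ _ _ (mZ k)).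
pose W : {mfun T >-> (size s).-tuple S} :=
  HB.pack (sample_tuple s) (isMeasurableFun.Build _ _ _ _ _ (@measurable_sample_tuple s)).
have mXW : measurable_fun setT (fun omega => (X omega, W omega)).
  by apply: measurable_fun_pair.
pose XW : {mfun T >-> (S * (size s).-tuple S)%type} :=
  HB.pack (fun omega => (X omega, W omega)) (isMeasurableFun.Build _ _ _ _ _ mXW).
have lawE := @product_measure_unique _ _ _ _ R (distribution P X) (distribution P W)
  (distribution P XW).
transitivity (\int[distribution P X]_x \int[distribution P W]_w Phi (x, w)).
  rewrite fubini_bounded//; congr fine.
  rewrite [RHS](eq_measure_integral (distribution P XW)); last first.
    by move=> A mA _; apply: lawE => // A' B mA' mB; exact: indep_sets.
  rewrite integral_distribution//.
    by apply/measurable_EFinP; case: bPhi.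
  apply: (@bounded_measurable_integrable _ _ _ P (fun omega => Phi (XW omega))).
  exact: bounded_measurable_comp.
have bPhil x : bounded_measurable (fun w => Phi (x, w)).
  exact: bounded_measurable_comp bPhi (measurable_pair1 _).
rewrite /Rintegral integral_distribution//.
- congr fine; apply: eq_integral => omega _ /=; congr (_%:E).
  rewrite /Rintegral integral_distribution//.
    by apply/measurable_EFinP; case: (bPhil (Z k omega)).
  apply: (@bounded_measurable_integrable _ _ _ P (fun o => Phi (X omega, W o))).
  by have := bounded_measurable_comp (bPhil (X omega)) (@measurable_sample_tuple s).
- apply/measurable_EFinP.
  by have [] := bounded_measurable_partial (distribution P X) (distribution P W) bPhi.
- apply: (@bounded_measurable_integrable _ _ _ P (fun omega =>
    \int[distribution P W]_w Phi (X omega, w))).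
  exact: (bounded_measurable_comp
    (bounded_measurable_partial (distribution P X) (distribution P W) bPhi) (mZ k)).
Qed.

(** Samples are lists rather than tuples, so that they grow by one observation
    without casts; measurability is that of tuples of each fixed size. *)
Definition sample_fun (Phi : seq S -> R) : Prop :=
  forall n, bounded_measurable (fun w : n.-tuple S => Phi w).

Lemma sample_fun_cons2 Phi n : sample_fun Phi ->
  bounded_measurable (fun p : S * n.-tuple S => Phi (p.1 :: p.2)).
Proof.
move=> mPhi; apply: (bounded_measurable_comp (mPhi n.+1)).
exact: (@measurable_cons _ _ _ _ fst n snd).
Qed.

Lemma sample_fun_cons Phi x : sample_fun Phi -> sample_fun (fun w => Phi (x :: w)).
Proof.
move=> mPhi n.
exact: (bounded_measurable_comp (sample_fun_cons2 n mPhi) (measurable_pair1 x)).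
Qed.

Lemma bounded_measurable_sample Phi s : sample_fun Phi ->
  bounded_measurable (fun omega => Phi (sample s omega)).
Proof.
move=> mPhi.
exact: (bounded_measurable_comp (mPhi (size s)) (@measurable_sample_tuple s)).
Qed.

Lemma bounded_measurable_sample_cons Phi s : sample_fun Phi ->
  bounded_measurable (fun x => \int[P]_omega Phi (x :: sample s omega)).
Proof.
move=> mPhi; apply: (bounded_measurable_partial (dirac (point : S) ) P
  (F := fun q => Phi (q.1 :: sample s q.2))).
apply: (bounded_measurable_comp (sample_fun_cons2 (size s) mPhi)
  (h := fun q => (q.1, sample_tuple s q.2))).
apply: measurable_fun_pair => //.
by apply: measurableT_comp => //; exact: measurable_sample_tuple.
Qed.

Lemma expect_cons Phi k s : uniq (k :: s) -> sample_fun Phi ->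
  \int[P]_omega Phi (sample (k :: s) omega) =
  \int[P]_omega' \int[P]_omega Phi (Z k omega' :: sample s omega).
Proof.
move=> us mPhi.
exact: (expect_sample_cons us (sample_fun_cons2 (size s) mPhi)).
Qed.

End independence.

(** * Bounded differences inequality *)

(** Invert the bound 1 - x <= exp (- x). *)
Lemma expR_le_quadratic (R : realType) (x : R) : x <= 2^-1 ->
  expR x <= 1 + x + 2 * x ^+ 2.
Proof.
move=> x_le; have x1 : 0 < 1 - x by lra.
have e1 : 1 - x <= expR (- x) by exact: expR_ge1Dx.
have -> : expR x = (expR (- x))^-1 by rewrite expRN invrK.
apply: (@le_trans _ _ (1 - x)^-1).
  by rewrite lef_pV2// posrE ?expR_gt0.
rewrite -[leLHS]mul1r ler_pdivrMr//.
have : 0 <= x ^+ 2 * (1 - 2 * x) by rewrite mulr_ge0 ?sqr_ge0//; lra.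
by rewrite -subr_ge0 => h; rewrite -subr_ge0; apply: le_trans h _; rewrite le_eqVlt;
  apply/orP; left; apply/eqP; ring.
Qed.

Section markov.
Context (R : realType) (d : measure_display) (T : measurableType d).
Variable P : probability T R.

Lemma probability_le_expect (A : set T) (g : T -> R) : measurable A ->
  bounded_measurable g -> (forall x, 0 <= g x) -> (forall x, A x -> 1 <= g x) ->
  (P A <= (\int[P]_x g x)%:E)%E.
Proof.
move=> mA bg g0 g1; rewrite -bounded_measurable_integralE//.
have -> : P A = (\int[P]_x (\1_A x)%:E)%E by rewrite integral_indic// setIT.
apply: ge0_le_integral => //.
- exact/measurable_EFinP/measurable_indic.
- by apply/measurable_EFinP; case: bg.
- move=> x _; rewrite lee_fin indicE; have [xA|_] := boolP (x \in A) => //=.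
  by apply: g1; rewrite inE in xA.
Qed.

Lemma expect_expR_le (f : T -> R) (c lam : R) :
  bounded_measurable f -> (forall x y, `|f x - f y| <= c) ->
  0 <= lam -> lam * c <= 2^-1 ->
  \int[P]_x expR (lam * f x)
    <= expR (2 * lam ^+ 2 * c ^+ 2) * expR (lam * \int[P]_x f x).
Proof.
move=> bf fc lam0 lamc; set e := \int[P]_x f x.
have fe x : `|f x - e| <= c.
  have bN : bounded_measurable (fun y => - f y) by exact: bounded_measurableN.
  have bD : bounded_measurable (fun y => f x + - f y).
    by apply: bounded_measurableD => //; exact: bounded_measurable_cst.
  have -> : f x - e = \int[P]_y (f x + - f y).
    by rewrite expectD ?expect_cst ?expectN//; exact: bounded_measurable_cst.
  apply: le_trans (norm_expect_le _ bD) _.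
  by apply: expect_le => [|y]; [exact: bounded_measurable_norm|exact: fc].
have bg : bounded_measurable (fun x => f x - e).
  by apply: bounded_measurableD => //; exact: bounded_measurable_cst.
have blg : bounded_measurable (fun x => lam * (f x - e)).
  by apply: bounded_measurableM => //; exact: bounded_measurable_cst.
have gE : \int[P]_x (f x - e) = 0.
  by rewrite expectD ?expect_cst ?subrr//; exact: bounded_measurable_cst.
have bq : bounded_measurable (fun x => 1 + 2 * lam ^+ 2 * c ^+ 2 + lam * (f x - e)).
  by apply: bounded_measurableD => //; exact: bounded_measurable_cst.
have -> : \int[P]_x expR (lam * f x) = expR (lam * e) * \int[P]_x expR (lam * (f x - e)).
  rewrite -expectZ; last exact: bounded_measurable_expR.
  by apply: eq_Rintegral => x _; rewrite -expRD; congr expR; ring.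
rewrite mulrC ler_wpM2r ?expR_ge0//.
apply: (@le_trans _ _ (1 + 2 * lam ^+ 2 * c ^+ 2)); last exact: expR_ge1Dx.
apply: (@le_trans _ _ (\int[P]_x (1 + 2 * lam ^+ 2 * c ^+ 2 + lam * (f x - e)))).
  apply: le_expect => // [|x]; first exact: bounded_measurable_expR.
  have lx : `|lam * (f x - e)| <= lam * c.
    by rewrite normrM (ger0_norm lam0) ler_wpM2l.
  apply: le_trans (expR_le_quadratic _) _.
    by rewrite (le_trans (ler_norm _))// (le_trans lx).
  rewrite -addrA [_ + 2 * _]addrC addrA lerD2r lerD2l -mulrA ler_wpM2l//.
  rewrite -exprMn -[leLHS]real_normK ?num_real// ler_sqr ?nnegrE//.
  exact: le_trans lx.
rewrite expectD ?expect_cst ?expectZ ?gE ?mulr0 ?addr0//.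
exact: bounded_measurable_cst.
Qed.

End markov.

Section bounded_differences.
Context (R : realType) (d d' : measure_display).
Context (T : measurableType d) (S : measurableType d').
Variables (P : probability T R) (Z : nat -> T -> S).
Hypothesis iidZ : iid P Z.

Definition bounded_differences (c : R) (Phi : seq S -> R) : Prop :=
  forall u v x y, `|Phi (u ++ x :: v) - Phi (u ++ y :: v)| <= c.

(** Integrating out all observations but the first one leaves a function of it
    whose oscillation is at most c; so each observation contributes a factor
    exp (2 lam^2 c^2) to the moment generating function.  This is McDiarmid's
    inequality, with worse constants since only the elementary bound
    exp x <= 1 + x + 2 x^2 is used. *)
Lemma expect_expR_bounded_differences (Phi : seq S -> R) (c lam : R) (s : seq nat) :
  uniq s -> sample_fun Phi -> bounded_differences c Phi ->
  0 <= lam -> lam * c <= 2^-1 ->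
  \int[P]_omega expR (lam * Phi (sample Z s omega))
    <= expR (2 * lam ^+ 2 * c ^+ 2 *+ size s)
       * expR (lam * \int[P]_omega Phi (sample Z s omega)).
Proof.
elim: s Phi => [|k s IHs] Phi us mPhi dPhi lam0 lamc.
  by rewrite /= mulr0n expR0 mul1r !expect_cst.
have bl (F : seq S -> R) : sample_fun F -> sample_fun (fun w => expR (lam * F w)).
  move=> mF n; apply: bounded_measurable_expR; apply: bounded_measurableM => //.
  exact: bounded_measurable_cst.
rewrite (@expect_cons _ _ _ _ _ _ _ iidZ (fun w => expR (lam * Phi w)))//; last exact: bl.
rewrite (@expect_cons _ _ _ _ _ _ _ iidZ Phi)//.
have [mZ _ _] := iidZ.
have us' : uniq s by case/andP: us.
pose u x := \int[P]_omega Phi (x :: sample Z s omega).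
have bu : bounded_measurable u by exact: bounded_measurable_sample_cons.
have buZ : bounded_measurable (fun omega' => u (Z k omega')).
  exact: bounded_measurable_comp bu (mZ k).
have uc x y : `|u x - u y| <= c.
  have bx z : bounded_measurable (fun omega => Phi (z :: sample Z s omega)).
    exact: (bounded_measurable_sample iidZ s (sample_fun_cons z mPhi)).
  rewrite /u -expectN// -expectD//; last exact: bounded_measurableN.
  have bxy : bounded_measurable (fun omega =>
      Phi (x :: sample Z s omega) + - Phi (y :: sample Z s omega)).
    by apply: bounded_measurableD => //; exact: bounded_measurableN.
  apply: le_trans (norm_expect_le _ bxy) _.
  apply: expect_le => [|omega]; first exact: bounded_measurable_norm.
  exact: (dPhi [::]).
set q := 2 * lam ^+ 2 * c ^+ 2.
have bexpu : bounded_measurable (fun omega' => expR (lam * u (Z k omega'))).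
  apply: bounded_measurable_expR; apply: bounded_measurableM => //.
  exact: bounded_measurable_cst.
apply: (@le_trans _ _ (\int[P]_omega' (expR (q *+ size s) * expR (lam * u (Z k omega'))))).
  apply: le_expect => [||omega'].
  - exact: (bounded_measurable_comp
      (bounded_measurable_sample_cons iidZ s (bl _ mPhi)) (mZ k)).
  - by apply: bounded_measurableM => //; exact: bounded_measurable_cst.
  - apply: (IHs (fun w => Phi (Z k omega' :: w))) => //.
      exact: sample_fun_cons.
    by move=> a b x y; exact: (dPhi (_ :: a)).
rewrite expectZ//= mulrSr expRD -mulrA ler_wpM2l ?expR_ge0//.
exact: expect_expR_le.
Qed.

Lemma bounded_differences_tail (Phi : seq S -> R) (c lam t : R) (s : seq nat) :
  uniq s -> sample_fun Phi -> bounded_differences c Phi ->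
  0 <= lam -> lam * c <= 2^-1 ->
  (P [set omega | (\int[P]_o Phi (sample Z s o) + t < Phi (sample Z s omega))%R]
   <= (expR (2 * lam ^+ 2 * c ^+ 2 *+ size s - lam * t))%:E)%E.
Proof.
move=> us mPhi dPhi lam0 lamc; set e := \int[P]_o _.
have bPhi := bounded_measurable_sample iidZ s mPhi.
have bl : bounded_measurable (fun omega => lam * Phi (sample Z s omega)).
  by apply: bounded_measurableM => //; exact: bounded_measurable_cst.
have bg : bounded_measurable (fun omega =>
    expR (- lam * (e + t)) * expR (lam * Phi (sample Z s omega))).
  apply: bounded_measurableM; first exact: bounded_measurable_cst.
  exact: bounded_measurable_expR.
apply: le_trans (probability_le_expect P _ bg _ _) _.
- have [mPhiZ _] := bPhi.
  rewrite -[X in measurable X]setTI.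
  by apply: (measurable_fun_ltr (f := cst (e + t))) => //; exact: measurable_cst.
- by move=> omega; rewrite mulr_ge0 ?expR_ge0.
- move=> omega /= et; rewrite -expRD -expR0 ler_expR mulNr addrC subr_ge0.
  by rewrite ler_wpM2l// ltW.
rewrite lee_fin expectZ; last exact: bounded_measurable_expR.
have := expect_expR_bounded_differences us mPhi dPhi lam0 lamc.
rewrite -/e => h; apply: le_trans (ler_wpM2l (expR_ge0 _) h) _.
rewrite mulrCA -expRD -expRD ler_expR le_eqVlt; apply/orP; left; apply/eqP; ring.
Qed.

End bounded_differences.

(** * Symmetrization *)

Section sup_abs.
Context (R : realType) (I : finType).
Implicit Types c v : I -> R.

Definition sup_abs c : R := \big[Num.max/0]_(i : I) `|c i|.

Lemma sup_abs_ge0 c : 0 <= sup_abs c.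
Proof. exact: bigmax_ge_id. Qed.

Lemma le_sup_abs c i : `|c i| <= sup_abs c.
Proof. exact: le_bigmax. Qed.

Lemma sup_abs_le c (a : R) : 0 <= a -> (forall i, `|c i| <= a) -> sup_abs c <= a.
Proof. by move=> a0 ca; apply: bigmax_le. Qed.

Lemma sup_absD c v : sup_abs (fun i => c i + v i) <= sup_abs c + sup_abs v.
Proof.
apply: sup_abs_le => [|i]; first by rewrite addr_ge0 ?sup_abs_ge0.
by rewrite (le_trans (ler_normD _ _))// lerD ?le_sup_abs.
Qed.

(** Average of G over the end points of all walks that start at c and whose
    successive steps are plus or minus the vectors of l; the recursion replaces
    an explicit sum over vectors of signs. *)
Fixpoint rademacher (l : seq (I -> R)) (G : (I -> R) -> R) c : R :=
  if l is v :: l' then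
    2^-1 * (rademacher l' G (fun i => c i + v i)
            + rademacher l' G (fun i => c i - v i))
  else G c.

Lemma bounded_measurable_rademacher (d : measure_display) (X : measurableType d)
    (h : seq (X -> I -> R)) (c : X -> I -> R) :
  (forall i, bounded_measurable (fun x => c x i)) ->
  (forall k i, bounded_measurable (fun x => nth (fun=> cst 0) h k x i)) ->
  bounded_measurable (fun x => rademacher [seq f x | f <- h] sup_abs (c x)).
Proof.
elim: h c => [|f h IHh] c bc bh /=.
  apply: bounded_measurable_bigmax => i.
  exact: bounded_measurable_norm.
have bf i : bounded_measurable (fun x => f x i) by exact: (bh 0%N).
have {}bh k i : bounded_measurable (fun x => nth (fun=> cst 0) h k x i).
  exact: (bh k.+1).
apply: bounded_measurableM; first exact: bounded_measurable_cst.
apply: bounded_measurableD.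
  by apply: (IHh (fun x i => c x i + f x i)) => // i; exact: bounded_measurableD.
apply: (IHh (fun x i => c x i - f x i)) => // i.
by apply: bounded_measurableD => //; exact: bounded_measurableN.
Qed.

End sup_abs.

Section symmetrization.
Context (R : realType) (d d' : measure_display).
Context (T : measurableType d) (S : measurableType d').
Variables (P : probability T R) (Z : nat -> T -> S).
Hypothesis iidZ : iid P Z.

Lemma expect_iid (f : S -> R) k : bounded_measurable f ->
  \int[P]_omega f (Z k omega) = \int[P]_omega f (Z 0%N omega).
Proof.
move=> bf; have [mZ idZ _] := iidZ.
pose X i : {mfun T >-> S} := HB.pack (Z i) (isMeasurableFun.Build _ _ _ _ _ (mZ i)).
have XE i : \int[P]_omega f (Z i omega) = \int[distribution P (X i)]_x f x.
  rewrite /Rintegral integral_distribution//.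
    by apply/measurable_EFinP; case: bf.
  apply: (@bounded_measurable_integrable _ _ _ P (fun o => f (X i o))).
  exact: (bounded_measurable_comp bf (mZ i)).
rewrite !XE; congr fine; apply: eq_measure_integral => A mA _.
exact: idZ.
Qed.

Variables (I : finType) (g : I -> S -> R).
Hypothesis bg : forall i, bounded_measurable (g i).

Let mean i : R := \int[P]_omega g i (Z 0%N omega).
Let step y : I -> R := fun i => 2 * g i y.

Let bgZ k i : bounded_measurable (fun omega => g i (Z k omega)).
Proof. by have [mZ _ _] := iidZ; exact: (bounded_measurable_comp (bg i) (mZ k)). Qed.

Let bsup (c : T -> I -> R) : (forall i, bounded_measurable (fun o => c o i)) ->
  bounded_measurable (fun o => sup_abs (c o)).
Proof.
move=> bc; apply: bounded_measurable_bigmax => i; exact: bounded_measurable_norm.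
Qed.

Let baff (a : R) (c : I -> R) k i :
  bounded_measurable (fun o => c i + a * g i (Z k o)).
Proof.
apply: bounded_measurableD; first exact: bounded_measurable_cst.
by apply: bounded_measurableM => //; exact: bounded_measurable_cst.
Qed.

(** The point c + (g - mean) is the midpoint of c + 2 g and c - 2 mean; convexity
    of the supremum, and Jensen's inequality for the second of these points,
    give an average over two signs. *)
Let symmetrize1 k c :
  \int[P]_o sup_abs (fun i => c i + (g i (Z k o) - mean i)) <=
  \int[P]_o (2^-1 * (sup_abs (fun i => c i + step (Z k o) i)
                     + sup_abs (fun i => c i - step (Z k o) i))).
Proof.
have b1 : bounded_measurable (fun o => sup_abs (fun i => c i + step (Z k o) i)).
  by apply: bsup => i; exact: baff.
have b2 : bounded_measurable (fun o => sup_abs (fun i => c i - step (Z k o) i)).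
  by apply: bsup => i; under eq_fun do rewrite -mulNr; exact: baff.
have b3 : bounded_measurable
    (fun o => sup_abs (fun i => c i + (g i (Z k o) - mean i))).
  apply: bsup => i; apply: bounded_measurableD; first exact: bounded_measurable_cst.
  by apply: bounded_measurableD => //; exact: bounded_measurable_cst.
rewrite expectZ ?expectD//; last exact: bounded_measurableD.
set e := \int[P]_o sup_abs (fun i => c i - step (Z k o) i).
have em : sup_abs (fun i => c i - 2 * mean i) <= e.
  apply: sup_abs_le => [|i].
    by apply: expect_ge => // o; exact: sup_abs_ge0.
  have -> : c i - 2 * mean i = \int[P]_o (c i + (- 2) * g i (Z k o)).
    rewrite expectD ?expectZ ?expect_cst ?expect_iid ?mulNr//.
      exact: bounded_measurable_cst.
    by apply: bounded_measurableM => //; exact: bounded_measurable_cst.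
  apply: le_trans (norm_expect_le _ (baff _ _ _ _)) _.
  apply: le_expect => // [|o]; first exact: bounded_measurable_norm (baff _ _ _ _).
  by rewrite mulNr; exact: (le_sup_abs (fun i => c i - step (Z k o) i)).
rewrite -(expect_cst P e) -expectD//; last exact: bounded_measurable_cst.
have be : bounded_measurable
    (fun o => sup_abs (fun i => c i + step (Z k o) i) + e).
  by apply: bounded_measurableD => //; exact: bounded_measurable_cst.
rewrite -expectZ//; apply: le_expect => // [|o].
  by apply: bounded_measurableM => //; exact: bounded_measurable_cst.
apply: sup_abs_le => [|i].
  rewrite mulr_ge0 ?invr_ge0// addr_ge0 ?sup_abs_ge0//.
  exact: le_trans (sup_abs_ge0 _) em.
have -> : c i + (g i (Z k o) - mean i) =
    2^-1 * ((c i + step (Z k o) i) + (c i - 2 * mean i)).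
  by rewrite /step; field.
rewrite normrM gtr0_norm ?invr_gt0// ler_wpM2l ?invr_ge0//.
apply: le_trans (ler_normD _ _) _; apply: lerD.
  exact: (le_sup_abs (fun i => c i + step (Z k o) i)).
by apply: le_trans em; exact: (le_sup_abs (fun i => c i - 2 * mean i)).
Qed.

Let brad (l : seq (I -> R)) (c : T -> I -> R) :
  (forall i, bounded_measurable (fun o => c o i)) ->
  bounded_measurable (fun o => rademacher l (@sup_abs R I) (c o)).
Proof.
move=> bc.
have := @bounded_measurable_rademacher R I _ T [seq (fun _ : T => v) | v <- l] c bc.
rewrite (_ : (fun x => rademacher [seq f x | f <- [seq fun=> v | v <- l]] _ _) =
  (fun o => rademacher l (@sup_abs R I) (c o))); last first.
  by apply/funext => o; rewrite -map_comp map_id.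
apply=> k i; have [kl|kl] := ltnP k (size l).
  by rewrite (nth_map (fun=> 0))//; exact: bounded_measurable_cst.
by rewrite nth_default ?size_map//; exact: bounded_measurable_cst.
Qed.

Let symmetrize1_rademacher k l c :
  \int[P]_o rademacher l (@sup_abs R I) (fun i => c i + (g i (Z k o) - mean i)) <=
  \int[P]_o (2^-1 * (rademacher l (@sup_abs R I) (fun i => c i + step (Z k o) i)
                     + rademacher l (@sup_abs R I) (fun i => c i - step (Z k o) i))).
Proof.
elim: l c => [|v l IHl] c; first exact: symmetrize1.
have bm (e : I -> R) : bounded_measurable (fun o =>
    rademacher l (@sup_abs R I) (fun i => e i + (g i (Z k o) - mean i))).
  apply: brad => i; apply: bounded_measurableD; first exact: bounded_measurable_cst.
  by apply: bounded_measurableD => //; exact: bounded_measurable_cst.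
have bp (e : I -> R) : bounded_measurable (fun o =>
    rademacher l (@sup_abs R I) (fun i => e i + step (Z k o) i)).
  by apply: brad => i; exact: baff.
have bn (e : I -> R) : bounded_measurable (fun o =>
    rademacher l (@sup_abs R I) (fun i => e i - step (Z k o) i)).
  by apply: brad => i; under eq_fun do rewrite -mulNr; exact: baff.
have bpn (e : I -> R) : bounded_measurable (fun o => 2^-1 * (
    rademacher l (@sup_abs R I) (fun i => e i + step (Z k o) i) +
    rademacher l (@sup_abs R I) (fun i => e i - step (Z k o) i))).
  apply: bounded_measurableM; first exact: bounded_measurable_cst.
  exact: bounded_measurableD.
pose cp i := c i + v i; pose cm i := c i - v i.
have -> : \int[P]_o rademacher (v :: l) (@sup_abs R I)
      (fun i => c i + (g i (Z k o) - mean i)) =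
    2^-1 * (\int[P]_o rademacher l (@sup_abs R I) (fun i => cp i + (g i (Z k o) - mean i))
     + \int[P]_o rademacher l (@sup_abs R I) (fun i => cm i + (g i (Z k o) - mean i))).
  rewrite -expectD// -expectZ//; last exact: bounded_measurableD.
  apply: eq_Rintegral => o _ /=; congr (_ * (_ + _)); congr rademacher;
    by apply/funext => i; rewrite addrAC.
have -> : \int[P]_o (2^-1 * (rademacher (v :: l) (@sup_abs R I) (fun i => c i + step (Z k o) i)
      + rademacher (v :: l) (@sup_abs R I) (fun i => c i - step (Z k o) i))) =
    2^-1 * (\int[P]_o (2^-1 * (
    rademacher l (@sup_abs R I) (fun i => cp i + step (Z k o) i) +
    rademacher l (@sup_abs R I) (fun i => cp i - step (Z k o) i)))
    + \int[P]_o (2^-1 * (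
    rademacher l (@sup_abs R I) (fun i => cm i + step (Z k o) i) +
    rademacher l (@sup_abs R I) (fun i => cm i - step (Z k o) i)))).
  rewrite -expectD// -expectZ//; last exact: bounded_measurableD.
  apply: eq_Rintegral => o _ /=; rewrite -!mulrDr; congr (_ * (_ * _)).
  rewrite -addrACA; congr (_ + _ + (_ + _)); congr rademacher;
    by apply/funext => i; rewrite addrAC.
by rewrite ler_wpM2l ?invr_ge0// lerD.
Qed.

Let sample_fun_step c :
  sample_fun (fun w => rademacher [seq step y | y <- w] (@sup_abs R I) c).
Proof.
move=> n.
have := @bounded_measurable_rademacher R I _ (n.-tuple S)
  [seq (fun w : n.-tuple S => step (tnth w j)) | j <- enum 'I_n] (fun=> c).
rewrite (_ : (fun x : n.-tuple S => _) =
  (fun w : n.-tuple S => rademacher [seq step y | y <- w] (@sup_abs R I) c)); last first.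
  apply/funext => w; congr rademacher; rewrite -map_comp.
  by rewrite -[in RHS](map_tnth_enum w) -map_comp.
apply=> [i|k i]; first exact: bounded_measurable_cst.
have [kn|kn] := ltnP k n; last first.
  rewrite nth_default; first exact: bounded_measurable_cst.
  by rewrite size_map size_enum_ord.
rewrite (nth_map (Ordinal kn)); last by rewrite size_enum_ord.
apply: bounded_measurableM; first exact: bounded_measurable_cst.
exact: (bounded_measurable_comp (bg i) (measurable_tnth _)).
Qed.

Lemma sample_fun_centred c :
  sample_fun (fun w => sup_abs (fun i => c i + \sum_(y <- w) (g i y - mean i))).
Proof.
move=> n; apply: bounded_measurable_bigmax => i; apply: bounded_measurable_norm.
apply: bounded_measurableD; first exact: bounded_measurable_cst.
under eq_fun do rewrite big_tuple.
apply: bounded_measurable_sum => j; apply: bounded_measurableD.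
  exact: (bounded_measurable_comp (bg i) (measurable_tnth _)).
exact: bounded_measurable_cst.
Qed.

(** Observations are symmetrized one at a time: conditionally on one of them the
    induction hypothesis holds from any starting point, and after exchanging the
    integrals this one is symmetrized with the signs and the values of the
    others frozen. *)
Lemma expect_symmetrize (s : seq nat) (c : I -> R) : uniq s ->
  \int[P]_o sup_abs (fun i => c i + \sum_(y <- sample Z s o) (g i y - mean i)) <=
  \int[P]_o rademacher [seq step y | y <- sample Z s o] (@sup_abs R I) c.
Proof.
elim: s c => [|k s IHs] c us.
  by rewrite /= !expect_cst; under eq_fun do rewrite big_nil addr0.
have [mZ _ _] := iidZ.
rewrite (expect_cons iidZ us (sample_fun_centred c)).
rewrite (expect_cons iidZ us (sample_fun_step c)).
pose Phi (q : T * T) := rademacher [seq step y | y <- sample Z s q.2] (@sup_abs R I)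
  (fun i => c i + (g i (Z k q.1) - mean i)).
have bPhi : bounded_measurable Phi.
  have := @bounded_measurable_rademacher R I _ (T * T)%type
    [seq (fun q : T * T => step (Z j q.2)) | j <- s]
    (fun q i => c i + (g i (Z k q.1) - mean i)).
  rewrite (_ : (fun q : T * T => _) = Phi); last first.
    by apply/funext => q; congr rademacher; rewrite -!map_comp.
  apply=> [i|j i].
    apply: bounded_measurableD; first exact: bounded_measurable_cst.
    apply: bounded_measurableD; last exact: bounded_measurable_cst.
    exact: (bounded_measurable_comp (bgZ k i)).
  have [js|js] := ltnP j (size s); last first.
    by rewrite nth_default ?size_map//; exact: bounded_measurable_cst.
  rewrite (nth_map 0%N)//.
  apply: bounded_measurableM; first exact: bounded_measurable_cst.
  exact: (bounded_measurable_comp (bgZ _ i)).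
apply: (@le_trans _ _ (\int[P]_o' \int[P]_o Phi (o', o))).
  apply: le_expect => [||o'].
  - exact: (bounded_measurable_comp
      (bounded_measurable_sample_cons iidZ s (sample_fun_centred c)) (mZ k)).
  - exact: bounded_measurable_partial.
  - under eq_Rintegral do under eq_fun do rewrite big_cons addrA.
    by apply: IHs; case/andP: us.
rewrite (fubini_bounded_swap _ _ bPhi).
pose Psi (q : T * T) := rademacher [seq step y | y <- Z k q.1 :: sample Z s q.2]
  (@sup_abs R I) c.
have bPsi : bounded_measurable Psi.
  apply: (bounded_measurable_comp (sample_fun_cons2 (size s) (sample_fun_step c))
    (h := fun q => (Z k q.1, sample_tuple Z s q.2))).
  apply: measurable_fun_pair.
    by apply: measurableT_comp => //; exact: mZ.
  by apply: measurableT_comp => //; exact: (measurable_sample_tuple iidZ).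
rewrite [leRHS](fubini_bounded_swap P P bPsi).
apply: le_expect => [||o].
- exact: (bounded_measurable_partial P P (F := fun q => Phi (q.2, q.1))
    (bounded_measurable_comp bPhi (@measurable_swap _ _ T T))).
- exact: (bounded_measurable_partial P P (F := fun q => Psi (q.2, q.1))
    (bounded_measurable_comp bPsi (@measurable_swap _ _ T T))).
- exact: (symmetrize1_rademacher k [seq step y | y <- sample Z s o] c).
Qed.

End symmetrization.

(** * Uniform law of large numbers *)

Lemma cosh_le (R : realType) (x : R) : `|x| <= 2^-1 ->
  2^-1 * (expR x + expR (- x)) <= expR (2 * x ^+ 2).
Proof.
move=> x12; apply: le_trans (expR_ge1Dx _).
have h1 : expR x <= 1 + x + 2 * x ^+ 2.
  by apply: expR_le_quadratic; rewrite (le_trans (ler_norm _)).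
have h2 : expR (- x) <= 1 - x + 2 * x ^+ 2.
  have := @expR_le_quadratic R (- x); rewrite sqrrN; apply.
  by rewrite (le_trans (ler_norm _))// normrN.
lra.
Qed.

Section rademacher_cover.
Context (R : realType) (I : finType).
Implicit Types (c : I -> R) (l : seq (I -> R)) (r : seq I).

(** Restricting the supremum to the coordinates in r costs at most the l1
    distance of any coordinate to one of them, whatever the signs. *)
Lemma rademacher_restrict l r c (D : R) : 0 <= D ->
  (forall j, exists2 k, k \in r &
     `|c j - c k| + \sum_(v <- l) `|v j - v k| <= D) ->
  rademacher l (@sup_abs R I) c <=
  D + rademacher l (fun c' => \big[Num.max/0]_(k <- r) `|c' k|) c.
Proof.
move=> D0; elim: l c => [|v l IHl] c cD /=.
  apply: sup_abs_le => [|j]; first by rewrite addr_ge0// bigmax_ge_id.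
  have [k kr] := cD j; rewrite big_nil addr0 => jk.
  have -> : c j = (c j - c k) + c k by rewrite subrK.
  apply: le_trans (ler_normD _ _) _; apply: lerD => //.
  apply: le_bigmax_seq kr _ => //.
have -> : forall a b : R, D + 2^-1 * (a + b) = 2^-1 * ((D + a) + (D + b)).
  by move=> a b; field.
rewrite ler_wpM2l ?invr_ge0//.
apply: lerD; apply: IHl => j; have [k kr] := cD j; rewrite big_cons addrA => jk;
  exists k => //; apply: le_trans jk; rewrite lerD2r.
  have -> : c j + v j - (c k + v k) = (c j - c k) + (v j - v k) by ring.
  exact: ler_normD.
have -> : c j - v j - (c k - v k) = (c j - c k) - (v j - v k) by ring.
exact: ler_normB.
Qed.

(** Since x <= t + exp (lam (x - t)) / lam, a maximum is bounded by a sum of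
    exponentials, whose averages over the signs factor into hyperbolic
    cosines. *)
Lemma rademacher_exp_le l r c (b lam t : R) : 0 <= t -> 0 < lam ->
  lam * b <= 2^-1 -> (forall k v, v \in map (@^~ k) l -> `|v| <= b) ->
  rademacher l (fun c' => \big[Num.max/0]_(k <- r) `|c' k|) c <=
  t + lam^-1 * expR (2 * lam ^+ 2 * b ^+ 2 *+ size l - lam * t)
      * \sum_(k <- r) (expR (lam * c k) + expR (- (lam * c k))).
Proof.
move=> t0 lam0 lamb; elim: l c => [|v l IHl] c lb /=.
  rewrite mulr0n sub0r.
  elim: r => [|k r IHr]; first by rewrite !big_nil mulr0 addr0.
  rewrite !big_cons ge_max; apply/andP; split; last first.
    apply: le_trans IHr _; rewrite lerD2l ler_wpM2l//.
      by rewrite mulr_ge0 ?invr_ge0 ?expR_ge0// ltW.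
    by rewrite lerDr addr_ge0 ?expR_ge0.
  rewrite -lerBlDl -mulrA -ler_pdivrMl ?invr_gt0// invrK.
  apply: (@le_trans _ _ (expR (lam * (`|c k| - t)))).
    by apply: le_trans (expR_ge1Dx _); rewrite lerDr.
  rewrite mulrBr addrC expRD ler_wpM2l ?expR_ge0//.
  apply: (@le_trans _ _ (expR (lam * c k) + expR (- (lam * c k)))).
    have [_|_] := ger0P (c k); first by rewrite lerDl expR_ge0.
    by rewrite mulrN lerDr expR_ge0.
  rewrite lerDl; apply: sumr_ge0 => i _; by rewrite addr_ge0 ?expR_ge0.
have {}lb' : forall k w, w \in map (@^~ k) l -> `|w| <= b.
  by move=> k w wl; apply: (lb k); rewrite /= inE wl orbT.
have vb k : `|v k| <= b by apply: (lb k); rewrite /= mem_head.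
set q := 2 * lam ^+ 2 * b ^+ 2.
have step := IHl _ lb'.
apply: (@le_trans _ _ (t + lam^-1 * expR (q *+ size l - lam * t) *
    \sum_(k <- r) (2^-1 * (expR (lam * v k) + expR (- (lam * v k))) *
      (expR (lam * c k) + expR (- (lam * c k)))))).
  apply: (@le_trans _ _ (2^-1 * ((t + lam^-1 * expR (q *+ size l - lam * t) *
      \sum_(k <- r) (expR (lam * (c k + v k)) + expR (- (lam * (c k + v k)))))
    + (t + lam^-1 * expR (q *+ size l - lam * t) *
      \sum_(k <- r) (expR (lam * (c k - v k)) + expR (- (lam * (c k - v k)))))))).
    by rewrite ler_wpM2l ?invr_ge0// lerD.
  set C := lam^-1 * _.
  rewrite (_ : forall A B : R, 2^-1 * ((t + C * A) + (t + C * B)) =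
    t + C * (2^-1 * (A + B))); last by move=> A B; field.
  rewrite -big_split /= mulr_sumr lerD2l le_eqVlt; apply/orP; left; apply/eqP.
  congr (_ * _); apply: eq_bigr => k _.
  by rewrite !mulrDr !mulrN !opprD !opprK !expRD; field.
rewrite lerD2l (mulrSr q) addrAC (expRD _ q) -!mulrA.
rewrite ler_wpM2l ?invr_ge0 ?(ltW lam0)// ler_wpM2l ?expR_ge0//.
rewrite mulr_sumr ler_sum// => k _.
rewrite ler_wpM2r ?addr_ge0 ?expR_ge0//.
apply: le_trans (cosh_le _) _.
  rewrite normrM gtr0_norm//; apply: le_trans lamb.
  by rewrite ler_wpM2l// ltW.
rewrite ler_expR exprMn mulrA ler_wpM2l ?mulr_ge0 ?(ltW lam0)//.
rewrite -[leLHS]real_normK ?num_real// ler_sqr ?nnegrE//.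
exact: le_trans (vb k).
Qed.

Lemma rademacher_le l (b : R) c : (forall k v, v \in map (@^~ k) l -> `|v| <= b) ->
  0 <= b -> rademacher l (@sup_abs R I) c <= sup_abs c + b *+ size l.
Proof.
move=> + b0; elim: l c => [|v l IHl] c lb /=; first by rewrite mulr0n addr0.
have {}lb' : forall k w, w \in map (@^~ k) l -> `|w| <= b.
  by move=> k w wl; apply: (lb k); rewrite /= inE wl orbT.
have vb : sup_abs v <= b.
  by apply: sup_abs_le => // k; apply: (lb k); rewrite /= mem_head.
have vNb : sup_abs (fun i => - v i) <= b.
  by apply: sup_abs_le => // k; rewrite normrN; apply: (lb k); rewrite /= mem_head.
rewrite (mulrS b).
have h1 := le_trans (IHl (fun i => c i + v i) lb') (lerD (sup_absD c v) (lexx _)).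
have h2 := le_trans (IHl (fun i => c i - v i) lb')
  (lerD (sup_absD c (fun i => - v i)) (lexx _)).
move: h1 h2 vb vNb; move: (rademacher _ _ _) (rademacher _ _ _) (b *+ _).
move: (sup_abs c) (sup_abs v) (sup_abs (fun i => - v i)) => a1 a2 a3 r1 r2 bl h1 h2 h3 h4.
lra.
Qed.

End rademacher_cover.

Section sup_deviation.
Context (R : realType) (d d' : measure_display).
Context (T : measurableType d) (S : measurableType d').
Variables (P : probability T R) (Z : nat -> T -> S) (M : R).
Hypotheses (iidZ : iid P Z) (M0 : 0 < M).

Definition measurable_0M (f : S -> R) : Prop :=
  measurable_fun setT f /\ forall x, 0 <= f x <= M.

Definition law_mean (f : S -> R) : R := \int[P]_omega f (Z 0%N omega).

Definition total_deviation (I : finType) (f : I -> S -> R) (w : seq S) : R :=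
  sup_abs (fun i => \sum_(y <- w) (f i y - law_mean (f i))).

Definition covered (n N : nat) (eps : R) (FF : set (S -> R)) (omega : T) : Prop :=
  exists c : 'I_N -> S -> R, forall f, FF f ->
    exists k, n%:R^-1 * \sum_(i < n) `|f (Z i omega) - c k (Z i omega)| < eps.

Lemma bounded_measurable_0M f : measurable_0M f -> bounded_measurable f.
Proof.
move=> [mf fM]; split => //; exists M => x.
by have /andP[f0 f1] := fM x; rewrite ger0_norm.
Qed.

Lemma sum_sample (F : S -> R) n omega :
  \sum_(y <- sample Z (iota 0 n) omega) F y = \sum_(i < n) F (Z i omega).
Proof. by rewrite big_map -{1}[n]subn0 -/(index_iota 0 n) big_mkord. Qed.

Section finite_family.
Context (I : finType).
Variable f : I -> S -> R.
Hypothesis fM : forall i, measurable_0M (f i).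

Lemma sample_fun_total_deviation : sample_fun (total_deviation f).
Proof.
have := sample_fun_centred P Z
  (fun i => bounded_measurable_0M (fM i)) (fun=> 0).
move=> + n => /(_ n); congr bounded_measurable; apply/funext => w.
by congr sup_abs; apply/funext => i; rewrite add0r.
Qed.

Lemma bounded_differences_total_deviation :
  bounded_differences M (total_deviation f).
Proof.
suff half u v x y : total_deviation f (u ++ x :: v) <= total_deviation f (u ++ y :: v) + M.
  move=> u v x y; have := half u v x y; have := half u v y x.
  by rewrite ler_distl => h1 h2; apply/andP; split; lra.
apply: sup_abs_le => [|i]; first by rewrite addr_ge0 ?sup_abs_ge0 ?ltW.
have -> : \sum_(z <- u ++ x :: v) (f i z - law_mean (f i)) =
    \sum_(z <- u ++ y :: v) (f i z - law_mean (f i)) + (f i x - f i y).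
  by rewrite !big_cat !big_cons /=; ring.
apply: le_trans (ler_normD _ _) _; apply: lerD.
  exact: (le_sup_abs (fun i => \sum_(z <- u ++ y :: v) (f i z - law_mean (f i)))).
have [_ /(_ x)] := fM i; have [_ /(_ y)] := fM i.
by rewrite ler_norml => h1 h2; lra.
Qed.

Let step y : I -> R := fun i => 2 * f i y.

Let walk n omega := [seq step y | y <- sample Z (iota 0 n) omega].

Let size_walk n omega : size (walk n omega) = n.
Proof. by rewrite !size_map size_iota. Qed.

Let walk_le n omega k v : v \in map (@^~ k) (walk n omega) -> `|v| <= 2 * M.
Proof.
move=> /mapP[u /mapP[y _ ->] ->].
have [_ /(_ y) /andP[h1 h2]] := fM k.
by rewrite /step normrM !ger0_norm// ler_wpM2l.
Qed.

(** A centre may lie outside the family, and be unbounded.  Each one is replaced by a member that it covers, which doubles the radius; together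
    with the factor 2 of the steps this explains the constant 4. *)
Let rademacher_covered n N (eps lam t : R) omega : (0 < n)%N -> 0 <= eps ->
  0 <= t -> 0 < lam -> lam * (2 * M) <= 2^-1 -> covered n N eps (range f) omega ->
  rademacher (walk n omega) (@sup_abs R I) (fun=> 0) <=
  4 * n%:R * eps + (t + lam^-1 * expR (2 * lam ^+ 2 * (2 * M) ^+ 2 *+ n - lam * t)
    * (2 * N%:R)).
Proof.
move=> n0 eps0 t0 lam0 lamM [c cover].
have n0' : 0 < n%:R :> R by rewrite ltr0n.
pose near k i := n%:R^-1 * \sum_(j < n) `|f i (Z j omega) - c k (Z j omega)| < eps.
pose r := pmap (fun k => [pick i | near k i]) (enum 'I_N).
have size_r : (size r <= N)%N.
  by rewrite size_pmap (leq_trans (count_size _ _))// size_enum_ord.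
apply: le_trans (rademacher_restrict (r := r) (D := 4 * n%:R * eps) _ _) _.
- by rewrite !mulr_ge0.
- move=> j; have [k jk] : exists k, near k j by apply: cover; exists j.
  have [i ik ir] : exists2 i, near k i & i \in r.
    case E : [pick i | near k i] => [i|].
      exists i; first by case: pickP E => // i' ? [<-].
      by rewrite mem_pmap -E; apply/mapP; exists k => //; rewrite mem_enum.
    by case: pickP E => // /(_ j); rewrite jk.
  exists i => //; rewrite subrr normr0 add0r big_map.
  rewrite sum_sample.
  have ltn a : n%:R^-1 * a < eps -> a < n%:R * eps by rewrite -ltr_pdivlMl ?invr_gt0// invrK.
  have {}jk := ltn _ jk; have {}ik := ltn _ ik.
  apply: (@le_trans _ _ (2 * (\sum_(m < n) `|f j (Z m omega) - c k (Z m omega)| +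
      \sum_(m < n) `|f i (Z m omega) - c k (Z m omega)|))); last by lra.
  rewrite -big_split mulr_sumr; apply: ler_sum => m _ /=.
  rewrite /step -mulrBr normrM ger0_norm// ler_wpM2l//.
  by rewrite [in leRHS](distrC (f i _)) ler_distD.
rewrite lerD2l.
apply: le_trans (rademacher_exp_le r _ t0 lam0 lamM (@walk_le n omega)) _.
rewrite lerD2l size_walk; apply: ler_wpM2l.
  by rewrite mulr_ge0 ?invr_ge0 ?expR_ge0 ?(ltW lam0).
under eq_bigr do rewrite mulr0 oppr0 expR0.
have -> : \sum_(k <- r) (1 + 1) = 2 * (size r)%:R :> R.
  rewrite -sum1_size natr_sum mulr_sumr; apply: eq_bigr => k _.
  by rewrite mulr1.
by apply: ler_wpM2l => //; rewrite ler_nat.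
Qed.

(** On the exceptional event B the trivial bound 2 M n is used, which is harmless
    in expectation: this is why covering numbers need to be controlled with
    large probability only. *)
Lemma expect_total_deviation_le n (A eps delta lam t : R) (B : set T) :
  (0 < n)%N -> 0 <= eps -> 0 <= t -> 0 < lam -> lam * (2 * M) <= 2^-1 -> 0 <= A ->
  measurable B -> (P B <= delta%:E)%E ->
  (forall omega, ~ B omega -> exists2 N, N%:R <= A & covered n N eps (range f) omega) ->
  \int[P]_omega total_deviation f (sample Z (iota 0 n) omega) <=
  4 * n%:R * eps
  + (t + lam^-1 * expR (2 * lam ^+ 2 * (2 * M) ^+ 2 *+ n - lam * t) * (2 * A))
  + 2 * M * n%:R * delta.
Proof.
move=> n0 eps0 t0 lam0 lamM A0 mB PB cover.
set K := 4 * n%:R * eps + _.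
have K0 : 0 <= K.
  by rewrite !(mulr_ge0, addr_ge0)// ?invr_ge0 ?expR_ge0 ?(ltW lam0).
have bI : bounded_measurable (\1_B : T -> R).
  split; first exact: measurable_indic.
  by exists 1 => x; rewrite indicE; case: (_ \in _); rewrite ?normr1 ?normr0.
have bKB : bounded_measurable (fun omega => K + 2 * M * n%:R * \1_B omega).
  apply: bounded_measurableD; first exact: bounded_measurable_cst.
  by apply: bounded_measurableM => //; exact: bounded_measurable_cst.
have bf i := bounded_measurable_0M (fM i).
apply: (@le_trans _ _ (\int[P]_omega (K + 2 * M * n%:R * \1_B omega))).
  have := expect_symmetrize iidZ bf (fun=> 0) (iota_uniq 0 n).
  have -> : (fun o => sup_abs (fun i => 0 + \sum_(y <- sample Z (iota 0 n) o)
      (f i y - \int[P]_omega f i (Z 0%N omega)))) =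
      (fun o => total_deviation f (sample Z (iota 0 n) o)).
    by apply/funext => o; congr sup_abs; apply/funext => i; rewrite add0r.
  move=> /le_trans; apply; apply: le_expect => // [|omega].
    have [mZ _ _] := iidZ.
    have := @bounded_measurable_rademacher R I _ T
      [seq (fun o => step (Z j o)) | j <- iota 0 n] (fun _ _ => 0).
    rewrite (_ : (fun o => rademacher [seq _ | _ <- _] _ _) =
      (fun o => rademacher (walk n o) (@sup_abs R I) (fun=> 0))); last first.
      by apply/funext => o; rewrite /walk /sample -!map_comp.
    apply=> [i|j i]; first exact: bounded_measurable_cst.
    have [jn|jn] := ltnP j n; last first.
      rewrite nth_default; first exact: bounded_measurable_cst.
      by rewrite size_map size_iota.
    rewrite (nth_map 0%N); last by rewrite size_iota.
    apply: bounded_measurableM; first exact: bounded_measurable_cst.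
    exact: (bounded_measurable_comp (bf i)).
  have [Bo|nBo] := pselect (B omega); last first.
    rewrite indicE memNset// mulr0 addr0; have [N NA cN] := cover _ nBo.
    apply: le_trans (rademacher_covered n0 eps0 t0 lam0 lamM cN) _.
    rewrite /K !lerD2l ler_wpM2l ?mulr_ge0 ?invr_ge0 ?expR_ge0 ?(ltW lam0)//.
    by rewrite ler_wpM2l.
  rewrite indicE mem_set// mulr1.
  apply: le_trans (rademacher_le (b := 2 * M) _ _ _) _.
  - exact: walk_le.
  - by rewrite mulr_ge0// ltW.
  rewrite size_walk; apply: lerD; last by rewrite mulr_natr.
  by apply: sup_abs_le => // i; rewrite normr0.
rewrite expectD//; last 2 first.
- exact: bounded_measurable_cst.
- by apply: bounded_measurableM => //; exact: bounded_measurable_cst.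
rewrite expect_cst expectZ// lerD2l ler_wpM2l ?mulr_ge0 ?(ltW M0)//.
rewrite -lee_fin (le_trans _ PB)// -bounded_measurable_integralE//.
by rewrite integral_indic// setIT.
Qed.

End finite_family.
End sup_deviation.

Lemma near_nat_ge (R : realType) (x : R) : \forall n \near \oo, x <= n%:R.
Proof.
exists (Num.truncn `|x|).+1 => // n /= xn.
rewrite (le_trans (ler_norm _))// (le_trans (ltW (truncnS_gt _)))//.
by rewrite ler_nat.
Qed.

Section borel_cantelli_geometric.
Context (R : realType) (d : measure_display) (T : measurableType d).
Variable P : probability T R.

Lemma ae_eventually_not (E : nat -> set T) (x : R) : 0 < x < 1 ->
  (forall n, measurable (E n)) ->
  (\forall n \near \oo, (P (E n) <= (x ^+ n)%:E)%E) ->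
  {ae P, forall omega, \forall n \near \oo, ~ E n omega}.
Proof.
move=> /andP[x0 x1] mE [n0 _ PE].
pose F n := if (n0 <= n)%N then E n else set0.
have mF n : measurable (F n) by rewrite /F; case: ifP.
have PF n : (P (F n) <= (x ^+ n)%:E)%E.
  rewrite /F; case: ifP => [/PE //|_].
  by rewrite measure0 lee_fin exprn_ge0// ltW.
have : (\sum_(n <oo) P (F n) < +oo)%E.
  apply: (@le_lt_trans _ _ ((1 * (1 - x)^-1)%:E)); last exact: ltry.
  apply: lime_le; first by apply: is_cvg_nneseries => n _ _; exact: measure_ge0.
  apply: nearW => n.
  apply: le_trans (lee_sum _ (fun i _ => PF i)) _.
  rewrite sumEFin lee_fin; have := @geometric_le_lim R n 1 x ler01 x0.
  rewrite ger0_norm ?(ltW x0)// => /(_ x1); apply: le_trans.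
  by rewrite le_eqVlt; apply/orP; left; apply/eqP; apply: eq_bigr => i _; rewrite /= mul1r.
move=> /(lim_sup_set_cvg0 mF) F0.
exists (lim_sup_set F); split => //.
  by apply: bigcap_measurable => // n _; apply: bigcup_measurable.
move=> omega /= nE n _; apply: contrapT => nF; apply: nE.
exists (maxn n n0) => // k /=; rewrite geq_max => /andP[nk n0k] Ek.
by apply: nF; exists k => //; rewrite /F n0k.
Qed.

End borel_cantelli_geometric.

Section uniform_law.
Context (R : realType) (d d' : measure_display).
Context (T : measurableType d) (S : measurableType d').
Variables (P : probability T R) (Z : nat -> T -> S) (M : R).
Hypotheses (iidZ : iid P Z) (M0 : 0 < M).
Variable FF : nat -> set (S -> R).
Hypothesis FFM : forall n f, FF n f -> measurable_0M M f.

(** The normalized logarithm of the covering numbers tends to 0 in probability;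
    the set B encloses an exceptional event that may not be measurable. *)
Definition subexponential_covering : Prop :=
  forall eps gamma delta : R, 0 < eps < 1 -> 0 < gamma -> 0 < delta ->
  \forall n \near \oo, exists B : set T, [/\ measurable B, (P B <= delta%:E)%E &
    forall omega, ~ B omega ->
      exists2 N, N%:R <= expR (gamma * n%:R) & covered Z n N eps (FF n) omega].

Hypothesis coverFF : subexponential_covering.

Let V n J (f : 'I_J -> S -> R) omega :=
  total_deviation P Z f (sample Z (iota 0 n) omega).

Let expect_deviation_small (eta : R) : 0 < eta <= M -> eta < 1 ->
  \forall n \near \oo, forall J (f : 'I_J -> S -> R), (forall i, FF n (f i)) ->
    \int[P]_omega V n f omega <= n%:R * eta.
Proof.
move=> /andP[eta0 etaM] eta1.
(* Four terms of the bound are n eta / 4 each; lam minimizes, up to a constant,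
   the exponent 2 lam^2 b^2 n - lam t, which with this gamma still leaves
   the rate exp (- gamma n). *)
pose b := 2 * M; have b0 : 0 < b by rewrite mulr_gt0.
pose eps := eta / 16; pose gamma := (eta / (16 * b)) ^+ 2.
pose delta := eta / (8 * M); pose lam := eta / (16 * b ^+ 2).
have gamma0 : 0 < gamma by rewrite exprn_gt0// divr_gt0 ?mulr_gt0.
have delta0 : 0 < delta by rewrite divr_gt0 ?mulr_gt0.
have lam0 : 0 < lam by rewrite divr_gt0 ?mulr_gt0 ?exprn_gt0.
have eps1 : 0 < eps < 1 by rewrite /eps; apply/andP; split; lra.
near=> n => J f Ff.
have n0 : (0 < n)%N by near: n; exists 1%N.
have nlarge : 8 / (eta * lam) <= n%:R by near: n; exact: near_nat_ge.
have [B [mB PB cover]] : exists B : set T, [/\ measurable B, (P B <= delta%:E)%E &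
    forall omega, ~ B omega ->
      exists2 N, N%:R <= expR (gamma * n%:R) & covered Z n N eps (FF n) omega].
  by near: n; exact: coverFF.
have fM i : measurable_0M M (f i) by exact: FFM (Ff i).
have lamb : lam * b <= 2^-1.
  have -> : lam * b = eta / (16 * b) by rewrite /lam; field; rewrite gt_eqF.
  by rewrite ler_pdivrMr ?mulr_gt0// /b; lra.
pose t := n%:R * (eta / 4).
apply: le_trans (expect_total_deviation_le (A := expR (gamma * n%:R)) (eps := eps)
  (delta := delta) (lam := lam) (t := t) iidZ M0 fM n0 _ _ lam0 lamb (expR_ge0 _) mB PB _) _.
- by rewrite /eps; lra.
- by rewrite mulr_ge0// ltW// divr_gt0.
- move=> omega nB; have [N NA [c cN]] := cover _ nB; exists N => //.
  by exists c => _ [i _ <-]; exact: cN.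
have -> : 4 * n%:R * eps = n%:R * (eta / 4) by rewrite /eps; field.
have -> : 2 * M * n%:R * delta = n%:R * (eta / 4).
  by rewrite /delta; field; rewrite gt_eqF.
have small : lam^-1 * expR (2 * lam ^+ 2 * (2 * M) ^+ 2 *+ n - lam * t) *
    (2 * expR (gamma * n%:R)) <= n%:R * (eta / 4).
  rewrite mulrACA mulrA -mulrA -expRD.
  apply: (@le_trans _ _ (lam^-1 * 2 * 1)).
    rewrite ler_wpM2l ?mulr_ge0 ?invr_ge0 ?(ltW lam0)// -[leRHS]expR0 ler_expR.
    rewrite (_ : _ + _ = - gamma * n%:R); last first.
      rewrite -[_ *+ n]mulr_natr -/b /t /gamma /lam. by field; rewrite gt_eqF.
    by rewrite mulNr oppr_le0 mulr_ge0 ?(ltW gamma0).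
  move: nlarge; rewrite (ler_pdivrMr _ _ (mulr_gt0 eta0 lam0)) => h.
  rewrite mulr1 mulrC (ler_pdivrMr _ _ lam0).
  have -> : n%:R * (eta / 4) * lam = n%:R * (eta * lam) / 4 by field.
  by lra.
apply: (@le_trans _ _ (n%:R * (eta / 4) + (t + n%:R * (eta / 4)) + n%:R * (eta / 4))).
  by rewrite lerD2r lerD2l lerD2l.
by rewrite /t le_eqVlt; apply/orP; left; apply/eqP; field.
Unshelve. all: by end_near.
Qed.

Let deviation_tail (eta : R) : 0 < eta <= M -> eta < 1 ->
  \forall n \near \oo, forall J (f : 'I_J -> S -> R), (forall i, FF n (f i)) ->
    (P [set omega | (2 * (n%:R * eta) < V n f omega)%R]
     <= (expR (- (eta ^+ 2 / (8 * M ^+ 2))) ^+ n)%:E)%E.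
Proof.
move=> etaM eta1; have /andP[eta0 etaM'] := etaM.
near=> n => J f Ff.
have EV : \int[P]_omega V n f omega <= n%:R * eta.
  by move: J f Ff; near: n; exact: expect_deviation_small.
have fM i : measurable_0M M (f i) by exact: FFM (Ff i).
pose lam := eta / (4 * M ^+ 2).
have lam0 : 0 < lam by rewrite divr_gt0 ?mulr_gt0 ?exprn_gt0.
have lamM : lam * M <= 2^-1.
  have -> : lam * M = eta / (4 * M) by rewrite /lam; field; rewrite gt_eqF.
  by rewrite ler_pdivrMr ?mulr_gt0//; lra.
have := bounded_differences_tail iidZ (n%:R * eta) (iota_uniq 0 n)
  (sample_fun_total_deviation P Z fM) (bounded_differences_total_deviation P Z M0 fM)
  (ltW lam0) lamM.
rewrite size_iota -expRM_natl.
rewrite (_ : 2 * lam ^+ 2 * M ^+ 2 *+ n - lam * (n%:R * eta) =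
  n%:R * - (eta ^+ 2 / (8 * M ^+ 2))); last first.
  rewrite -[2 * _ * _ *+ n]mulr_natr /lam.
  by field; rewrite gt_eqF.
move=> /(le_trans _); apply; apply: le_measure; rewrite ?inE.
- have [mV _] := bounded_measurable_sample iidZ (iota 0 n) (sample_fun_total_deviation P Z fM).
  rewrite -[X in measurable X]setTI.
  by apply: (measurable_fun_ltr (f := cst _)) => //; exact: measurable_cst.
- have [mV _] := bounded_measurable_sample iidZ (iota 0 n) (sample_fun_total_deviation P Z fM).
  rewrite -[X in measurable X]setTI.
  by apply: (measurable_fun_ltr (f := cst _)) => //; exact: measurable_cst.
- move=> omega /=; apply: le_lt_trans.
  rewrite [leRHS](_ : _ = n%:R * eta + n%:R * eta); last by ring.
  by rewrite lerD2r.
Unshelve. all: by end_near.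
Qed.

(* An event for a whole sequence of functions; it is the increasing union of
   those for its initial segments, so that bounds that are uniform over finite
   subfamilies carry over. *)
Let bad n (a : R) (f : nat -> S -> R) : set T :=
  [set omega | exists k, a < `|\sum_(i < n) (f k (Z i omega) - law_mean P Z (f k))|].

Let bad_bigcup n a f : 0 <= a ->
  bad n a f = \bigcup_J [set omega | a < V n (fun i : 'I_J => f i) omega].
Proof.
move=> a0; apply/seteqP; split => omega.
  move=> [k ak]; exists k.+1 => //=; apply: lt_le_trans ak _.
  have := le_sup_abs (fun i : 'I_k.+1 => \sum_(y <- sample Z (iota 0 n) omega)
    (f i y - law_mean P Z (f i))) ord_max.
  by rewrite (sum_sample Z (fun y => f k y - law_mean P Z (f k))).
move=> [J _ /= aV]; apply: contrapT => nbad.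
move: aV; apply/negP; rewrite -leNgt; apply: sup_abs_le => // i.
rewrite leNgt; apply/negP => ai; apply: nbad; exists i.
by rewrite -(sum_sample Z (fun y => f i y - law_mean P Z (f i))).
Qed.

Let measurable_V n a J (f : 'I_J -> S -> R) : (forall i, FF n (f i)) ->
  measurable [set omega | a < V n f omega].
Proof.
move=> Ff; have fM i : measurable_0M M (f i) by exact: FFM (Ff i).
have [mV _] := bounded_measurable_sample iidZ (iota 0 n) (sample_fun_total_deviation P Z fM).
rewrite -[X in measurable X]setTI.
by apply: (measurable_fun_ltr (f := cst _)) => //; exact: measurable_cst.
Qed.

Let bad_tail (eta : R) : 0 < eta <= M -> eta < 1 ->
  \forall n \near \oo, forall f : nat -> S -> R, (forall k, FF n (f k)) ->
    (P (bad n (2 * (n%:R * eta))%R f)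
     <= (expR (- (eta ^+ 2 / (8 * M ^+ 2))) ^+ n)%:E)%E.
Proof.
move=> etaM eta1; have /andP[eta0 etaM'] := etaM.
near=> n; move=> f Ff.
have tail J (g : 'I_J -> S -> R) : (forall i, FF n (g i)) ->
    (P [set omega | (2 * (n%:R * eta) < V n g omega)%R]
     <= (expR (- (eta ^+ 2 / (8 * M ^+ 2))) ^+ n)%:E)%E.
  by move: J g; near: n; exact: deviation_tail.
have a0 : 0 <= 2 * (n%:R * eta) by rewrite !mulr_ge0// ltW.
rewrite bad_bigcup//; set F := fun J : nat => [set omega | _ < _].
have mF J : measurable (F J) by exact: measurable_V.
have ndF : nondecreasing_seq F.
  move=> J K JK; apply/subsetPset => omega /=; rewrite /F /=.
  move=> /lt_le_trans; apply; apply: sup_abs_le => [|i]; first exact: sup_abs_ge0.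
  exact: (le_sup_abs (fun i : 'I_K => \sum_(y <- sample Z (iota 0 n) omega)
    (f i y - law_mean P Z (f i))) (widen_ord JK i)).
have cvgF := @nondecreasing_cvg_mu _ _ _ P F mF (bigcupT_measurable _ mF) ndF.
rewrite -(cvg_lim _ cvgF)//; apply: lime_le; first by apply/cvg_ex; eexists; exact: cvgF.
by apply: nearW => J; exact: tail.
Unshelve. all: by end_near.
Qed.

(** Expectations of suprema tend to 0, and deviations from these expectations have
    exponentially small, hence summable, probabilities.  As the classes change
    with n, there is no monotonicity in n to rely on instead. *)
Theorem ae_uniform_law (f : nat -> nat -> S -> R) : (forall n k, FF n (f n k)) ->
  {ae P, forall omega, forall eps : R, 0 < eps -> \forall n \near \oo, forall k,
    `|n%:R^-1 * \sum_(i < n) f n k (Z i omega) - law_mean P Z (f n k)| <= eps}.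
Proof.
move=> Ff.
pose eta (q : nat) : R := Num.min M 2^-1 / q.+1%:R.
have min0 : 0 < Num.min M 2^-1 by rewrite lt_min M0 invr_gt0 ltr0n.
have eta0 q : 0 < eta q by rewrite divr_gt0.
have etamin q : eta q <= Num.min M 2^-1.
  by rewrite ler_pdivrMr// ler_peMr ?ler1n// ltW.
have etaM q : 0 < eta q <= M.
  by rewrite eta0 (le_trans (etamin q))// ge_min lexx.
have eta1 q : eta q < 1.
  by rewrite (le_lt_trans (etamin q))// gt_min; apply/orP; right; lra.
have aebad q : {ae P, forall omega,
    \forall n \near \oo, ~ bad n (2 * (n%:R * eta q)) (f n) omega}.
  apply: (@ae_eventually_not _ _ _ _ _ (expR (- (eta q ^+ 2 / (8 * M ^+ 2))))).
  - rewrite expR_gt0 /= -expR0 ltr_expR oppr_lt0.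
    by rewrite divr_gt0 ?mulr_gt0 ?exprn_gt0.
  - move=> n; rewrite bad_bigcup; last by rewrite !mulr_ge0// ltW.
    by apply: bigcupT_measurable => J; exact: measurable_V.
  - by near=> n; move: (f n) (Ff n); near: n; exact: bad_tail.
have /ae_foralln := aebad; apply: filterS => omega ogood eps eps0.
have [q qeps] : exists q, 2 * eta q <= eps.
  exists (Num.truncn (2 * Num.min M 2^-1 / eps)).
  rewrite mulrA ler_pdivrMr// [eps * _]mulrC -ler_pdivrMr// ltW//.
  exact: truncnS_gt.
near=> n => k.
have n0 : (0 < n)%N by near: n; exists 1%N.
have ngood : ~ bad n (2 * (n%:R * eta q)) (f n) omega by near: n; exact: ogood.
apply: le_trans qeps.
rewrite leNgt; apply/negP => bigk; apply: ngood; exists k.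
have n0' : 0 < n%:R :> R by rewrite ltr0n.
have -> : \sum_(i < n) (f n k (Z i omega) - law_mean P Z (f n k)) =
    n%:R * (n%:R^-1 * \sum_(i < n) f n k (Z i omega) - law_mean P Z (f n k)).
  rewrite sumrB sumr_const card_ord mulrBr mulrA divff ?mul1r ?mulr_natl//.
  by rewrite gt_eqF.
by rewrite normrM gtr0_norm// mulrCA ltr_pM2l.
Unshelve. all: by end_near.
Qed.

End uniform_law.

(** * Monotone splines *)

Lemma cvg_sumr (R : realType) (T I : Type) (F : set_system T) {FF : Filter F}
    (r : seq I) (f : I -> T -> R) (a : I -> R) :
  (forall i, f i x @[x --> F] --> a i) ->
  \sum_(i <- r) f i x @[x --> F] --> \sum_(i <- r) a i.
Proof.
move=> fa; elim: r => [|i r IHr].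
  by rewrite big_nil; under eq_fun do rewrite big_nil; exact: cvg_cst.
by rewrite big_cons; under eq_fun do rewrite big_cons; exact: cvgD.
Qed.

Section bspline_piece.
Context (R : realType).
Variable tau : nat -> R.

(** The polynomial piece on the k-th knot interval: the same recursion, started
    from the indicator of that interval. *)
Fixpoint bspline_piece (k d j : nat) (t : R) : R :=
  match d with
  | 0 => (j == k)%:R
  | d'.+1 =>
      (t - tau j) / (tau (j + d'.+1)%N - tau j) * bspline_piece k d' j t
      + (tau (j + d'.+2)%N - t) / (tau (j + d'.+2)%N - tau j.+1)
        * bspline_piece k d' j.+1 t
  end.

Lemma bspline_piece_gt k d j t : (k < j)%N -> bspline_piece k d j t = 0.
Proof.
elim: d j => [|d IHd] j kj /=; first by rewrite gtn_eqF.
by rewrite !IHd ?mulr0 ?addr0// ltnW.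
Qed.

Lemma bspline_piece_lt k d j t : (j + d < k)%N -> bspline_piece k d j t = 0.
Proof.
elim: d j => [|d IHd] j kj /=; first by rewrite addn0 in kj; rewrite ltn_eqF.
by rewrite !IHd ?mulr0 ?addr0// ?addSn// ?(leq_ltn_trans _ kj)// addnS// ltnW.
Qed.

Lemma continuous_bspline_piece k d j : continuous (bspline_piece k d j).
Proof.
elim: d j => [|d IHd] j t /=; first exact: cvg_cst.
apply: cvgD; (apply: cvgM; last exact: IHd); apply: cvgM; try exact: cvg_cst.
  by apply: cvgB; [exact: cvg_id|exact: cvg_cst].
by apply: cvgB; [exact: cvg_cst|exact: cvg_id].
Qed.

(** Continuity of B-splines of positive degree at simple knots. *)
Lemma bspline_piece_knot k d j : tau k < tau k.+1 -> tau k.+1 < tau k.+2 ->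
  bspline_piece k d.+1 j (tau k.+1) = bspline_piece k.+1 d.+1 j (tau k.+1).
Proof.
move=> k1 k2; elim: d j => [|d IHd] j; last by rewrite /= in IHd *; rewrite !IHd.
rewrite /= !addn1 !addn2.
have [->|jk] := eqVneq j k.
  rewrite !eqxx (ltn_eqF (ltnSn k)) (gtn_eqF (ltnSn k)) !mulr0 !mulr1 addr0 add0r.
  by rewrite !divff ?subr_eq0 ?gt_eqF.
have [->|jk1] := eqVneq j k.+1.
  by rewrite subrr !mul0r !add0r (gtn_eqF (leqnSn k.+1)) (gtn_eqF (ltnSn k.+1)) !mulr0.
rewrite ?(negbTE jk) ?(negbTE jk1) ?eqSS ?(negbTE jk) !mulr0 !add0r ?addr0.
have [<-|] := eqVneq j.+1 k; last by rewrite mulr0.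
by rewrite subrr !mul0r.
Qed.

(** One step of de Boor's algorithm, on the coefficients. *)
Definition de_boor d (c : nat -> R) (t : R) (j : nat) : R :=
  (t - tau j) / (tau (j + d.+1)%N - tau j) * c j
  + (tau (j + d.+1)%N - t) / (tau (j + d.+1)%N - tau j) * c j.-1.

Lemma sum_bspline_pieceS N k d (c : nat -> R) t : (d < k < N)%N ->
  \sum_(j < N) c j * bspline_piece k d.+1 j t =
  \sum_(j < N) de_boor d c t j * bspline_piece k d j t.
Proof.
move=> /andP[dk kN].
transitivity (\sum_(j < N) (t - tau j) / (tau (j + d.+1)%N - tau j) * c j * bspline_piece k d j t
  + \sum_(j < N) (tau (j.+1 + d.+1)%N - t) / (tau (j.+1 + d.+1)%N - tau j.+1) * c j
    * bspline_piece k d j.+1 t).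
  rewrite -big_split /=; apply: eq_bigr => j _.
  by rewrite mulrDr !addnS !addSn; congr (_ + _); ring.
case: N kN => // N kN.
rewrite [in RHS](eq_bigr (fun j : 'I_N.+1 =>
   (t - tau j) / (tau (j + d.+1)%N - tau j) * c j * bspline_piece k d j t
   + (tau (j + d.+1)%N - t) / (tau (j + d.+1)%N - tau j) * c j.-1
     * bspline_piece k d j t)); last by move=> j _; rewrite /de_boor mulrDl.
rewrite big_split /=; congr (_ + _).
rewrite big_ord_recr [RHS]big_ord_recl /=.
by rewrite bspline_piece_gt// bspline_piece_lt ?add0n// !mulr0 addr0 add0r.
Qed.

End bspline_piece.

Section spline.
Context (R : realType) (l m : nat) (tau : nat -> R).
Hypotheses (knots : knot_seq l m tau) (l1 : (1 < l)%N).

Let d := l.-1.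
Let dS : d.+1 = l. Proof. by rewrite prednK// ltnW. Qed.

Lemma knot_leS j : (j.+1 < m + l.*2)%N -> tau j <= tau j.+1.
Proof.
move=> jm; have [tl tlt tr] := knots.
have [jl|jl] := ltnP j.+1 l; first by rewrite !tl// ltnW.
have [jm'|jm'] := ltnP j (m + l).
  by rewrite ltW// tlt// jm' andbT -ltnS prednK// ltnW.
by rewrite !tr// ?jm' ?(leqW jm')//= ltnW.
Qed.

Lemma knot_le i j : (i <= j)%N -> (j < m + l.*2)%N -> tau i <= tau j.
Proof.
move=> /subnKC <-; elim: (j - i)%N => [|q IHq] qm; first by rewrite addn0.
apply: le_trans (IHq _) _; first by rewrite addnS in qm; exact: ltnW.
by rewrite addnS; apply: knot_leS; rewrite -addnS.
Qed.

Let m2l : (m + l < m + l.*2)%N.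
Proof. by rewrite ltn_add2l -addnn -[X in (X < _)%N]addn0 ltn_add2l ltnW. Qed.

Lemma knot_first : tau d = 0.
Proof. by have [tl _ _] := knots; apply: tl; rewrite -dS. Qed.

Lemma knot_last : tau (m + l)%N = 1.
Proof. by have [_ _ tr] := knots; apply: tr; rewrite leqnn. Qed.

Lemma knot_in01 j : (j < m + l)%N -> tau j \in `[0, 1].
Proof.
move=> jm; rewrite in_itv /= -knot_last (knot_le (ltnW jm))// andbT.
have [tl _ _] := knots.
by rewrite -(tl 0%N) ?knot_le// ?(ltn_trans jm)// ltnW.
Qed.

Definition knot_interval (k : nat) (t : R) : Prop :=
  [/\ (d <= k)%N, (k < m + l)%N & tau k <= t <= tau k.+1].

Let knot_gap k : (d <= k)%N -> (k < m + l)%N -> tau k < tau k.+1.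
Proof. by have [_ tlt _] := knots; move=> dk km; apply: tlt; rewrite dk. Qed.

(** In degree 0 exactly one basis function is nonzero at t; the last interval is
    closed, which is the second alternative. *)
Let piece_halfopen k t : (d <= k)%N -> (k < m + l)%N -> tau k <= t ->
  t < tau k.+1 \/ (k.+1 = m + l)%N /\ t = 1 ->
  forall e j, (j + e < (m + l.*2).-1)%N ->
    bspline_deg tau e j t = bspline_piece tau k e j t.
Proof.
move=> dk km kt tk; elim=> [|e IHe] j je /=; last first.
  by rewrite !IHe ?addSnnS//; rewrite addnS in je; exact: ltnW.
rewrite addn0 in je.
have jm : (j.+1 < m + l.*2)%N.
  by move: je; rewrite -ltnS prednK// (leq_trans _ m2l).
have k1m : (k.+1 < m + l.*2)%N by exact: leq_ltn_trans km m2l.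
have k1le : tau k.+1 <= 1 by rewrite -knot_last knot_le.
congr (_%:R); congr nat_of_bool.
have [->|jk] := eqVneq j k.
  case: tk => [tk|[km' t1]]; first by rewrite kt tk.
  rewrite (knot_gap dk km) km' knot_last t1 !eqxx /= orbT//.
have [ltjk|lekj] := ltnP j k.
  have jt : tau j.+1 <= tau k by apply: knot_le => //; exact: ltn_trans k1m.
  have -> : (t < tau j.+1) = false by apply/negbTE; rewrite -leNgt (le_trans jt).
  rewrite andbF /=; apply/negbTE/negP => /and3P[_ /eqP j1 _].
  have := knot_gap dk km; rewrite ltNge => /negP; apply.
  by rewrite (le_trans k1le)// -j1.
have {}jk : (k < j)%N by rewrite ltn_neqAle eq_sym jk.
have kj : tau k.+1 <= tau j by apply: knot_le => //; exact: ltn_trans jm.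
case: tk => [tk|[km' t1]].
  rewrite [tau j <= t]leNgt (lt_le_trans tk kj) /=.
  by apply/negbTE/negP => /and3P[_ _ /eqP t1]; rewrite t1 ltNge k1le in tk.
have [_ _ tr] := knots.
have ml : (m + l <= j)%N by rewrite -km'.
have tj : tau j = 1 by apply: tr; rewrite ml ltnW.
have tj1 : tau j.+1 = 1 by apply: tr; rewrite (leqW ml).
by rewrite tj tj1 t1 ltxx andbF.
Qed.

Lemma bspline_piece_closed k t : knot_interval k t ->
  forall j, (j < m + l)%N -> bspline l tau j t = bspline_piece tau k d j t.
Proof.
move=> [dk km /andP[kt tk]] j jm; rewrite /bspline -/d.
have jd : (j + d < (m + l.*2).-1)%N.
  by rewrite -addnn addnA -[X in (_ + X).-1]dS addnS ltn_add2r.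
move: tk; rewrite le_eqVlt => /predU1P[tk|tk]; last by apply: piece_halfopen => //; left.
have [km'|km'] := eqVneq k.+1 (m + l)%N.
  apply: piece_halfopen => //; right; split => //.
  by rewrite tk km' knot_last.
have {}km' : (k.+1 < m + l)%N by rewrite ltn_neqAle km'.
have gap := knot_gap (leqW dk) km'.
rewrite (piece_halfopen (k := k.+1))//; last 3 first.
- exact: leqW.
- by rewrite tk.
- by left; rewrite tk.
have [d' dE] : exists d', d = d'.+1 by exists d.-1; rewrite prednK// -ltnS dS.
by rewrite tk dE bspline_piece_knot// knot_gap.
Qed.

Lemma knot_interval_exists t : t \in `[0, 1] -> exists k, knot_interval k t.
Proof.
rewrite in_itv /= => /andP[t0 t1].
suff H i : (d + i.+1 <= m + l)%N -> t <= tau (d + i.+1)%N -> exists k, knot_interval k t.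
  by apply: (H m); rewrite addnS -addSn dS addnC// knot_last.
elim: i => [|i IHi] im ti.
  exists d; rewrite addn1 in im ti; split => //.
  by rewrite knot_first t0.
have [ti'|ti'] := leP t (tau (d + i.+1)%N).
  by apply: IHi => //; rewrite addnS in im; exact: ltnW.
exists (d + i.+1)%N; split; first exact: leq_addr.
  by rewrite addnS in im.
by rewrite (ltW ti') -addnS.
Qed.

Let de_boor_convex k e j s : knot_interval k s -> (k - e <= j <= k)%N -> (e < d)%N ->
  0 <= (s - tau j) / (tau (j + e.+1)%N - tau j) <= 1 /\ tau j < tau (j + e.+1)%N.
Proof.
move=> [dk km /andP[ks sk]] /andP[kj jk] ed.
have jem : (j + e.+1 < m + l.*2)%N.
  rewrite -addnn addnA -addSn leq_add ?(leq_ltn_trans jk)//.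
  exact: leq_trans ed (leq_pred l).
have kje : (k.+1 <= j + e.+1)%N by rewrite addnS ltnS addnC -leq_subLR.
have jk' : tau j <= tau k by rewrite knot_le// (ltn_trans km).
have kje' : tau k.+1 <= tau (j + e.+1)%N by exact: knot_le.
have gap : tau j < tau (j + e.+1)%N.
  by rewrite (le_lt_trans jk')// (lt_le_trans (knot_gap dk km)).
split => //; rewrite divr_ge0 ?subr_ge0 ?(ltW gap) ?(le_trans jk')//=.
by rewrite ler_pdivrMr ?subr_gt0// mul1r lerD2r (le_trans sk).
Qed.

Let de_boorE k e c j s : knot_interval k s -> (k - e <= j <= k)%N -> (e < d)%N ->
  de_boor tau e c s j =
  c j.-1 + (s - tau j) / (tau (j + e.+1)%N - tau j) * (c j - c j.-1).
Proof.
move=> ks kj ed; have [_ gap] := de_boor_convex ks kj ed.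
by rewrite /de_boor; field; rewrite subr_eq0 gt_eqF.
Qed.

Let pred_range k e j : (d <= k)%N -> (e < d)%N -> (k - e <= j <= k)%N ->
  (k - e.+1 <= j.-1 <= k)%N /\ (0 < j)%N.
Proof.
move=> dk ed /andP[kj jk]; have j0 : (0 < j)%N.
  by rewrite (leq_trans _ kj)// subn_gt0 (leq_trans ed).
split => //; rewrite -ltnS prednK// (leq_trans _ kj) ?ltn_sub2l//=.
- by rewrite (leq_trans (leq_pred _)).
- exact: leq_trans ed dk.
Qed.

(** Each step of de Boor's algorithm replaces the active coefficients by convex
    combinations of consecutive ones, which preserves any bounds on them. *)
Let sum_piece_bounds k t e c (a b : R) : knot_interval k t -> (e <= d)%N ->
  (forall j, (k - e <= j <= k)%N -> a <= c j <= b) ->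
  a <= \sum_(j < m + l) c j * bspline_piece tau k e j t <= b.
Proof.
move=> kt; elim: e c => [|e IHe] c ed cab.
  have [_ km _] := kt.
  rewrite (bigD1 (Ordinal km)) //= eqxx mulr1 big1 ?addr0 ?cab ?subn0 ?leqnn// => j jk.
  by rewrite (_ : (j : nat) == k = false) ?mulr0//; apply: contraNF jk.
have [dk km _] := kt.
rewrite sum_bspline_pieceS; last by rewrite km andbT (leq_trans ed).
apply: IHe => [|j kj]; first exact: ltnW.
have [/andP[x0 x1] _] := de_boor_convex kt kj ed.
have [kj' j0] := pred_range dk ed kj.
rewrite (de_boorE _ kt kj ed); move: x0 x1; set x := _ / _ => x0 x1.
have /andP[a1 b1] := cab _ kj'.
have /andP[a2 b2] : a <= c j <= b.
  by apply: cab; case/andP: kj => kj ->; rewrite andbT (leq_trans _ kj)// leq_sub2l.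
have -> : c j.-1 + x * (c j - c j.-1) = (1 - x) * c j.-1 + x * c j by ring.
apply/andP; split.
  have -> : a = (1 - x) * a + x * a by ring.
  by rewrite lerD// ler_wpM2l// subr_ge0.
have -> : b = (1 - x) * b + x * b by ring.
by rewrite lerD// ler_wpM2l// subr_ge0.
Qed.

(** Run the algorithm at s <= t, with c <= c' both nondecreasing.  The weights of
    the larger coefficients increase with the point, so the order between
    the two runs persists; the new coefficients interlace the old ones, so each
    run stays nondecreasing. *)
Let sum_piece_monotone k s t e c c' : knot_interval k s -> knot_interval k t ->
  s <= t -> (e <= d)%N ->
  (forall j, (k - e <= j <= k)%N -> c j <= c' j) ->
  (forall j, (k - e < j <= k)%N -> c j.-1 <= c j /\ c' j.-1 <= c' j) ->
  \sum_(j < m + l) c j * bspline_piece tau k e j s <=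
  \sum_(j < m + l) c' j * bspline_piece tau k e j t.
Proof.
move=> ks kt st; elim: e c c' => [|e IHe] c c' ed cc' mc.
  apply: ler_sum => j _ /=; have [jk|_] := eqVneq (j : nat) k; last by rewrite !mulr0.
  by rewrite !mulr1 cc'// jk subn0 leqnn.
have [dk km _] := ks.
rewrite !sum_bspline_pieceS ?km ?andbT ?(leq_trans ed)//.
have range j : (k - e <= j <= k)%N -> (k - e.+1 < j <= k)%N.
  move=> /andP[kj ->]; rewrite andbT (leq_trans _ kj)// ltn_sub2l//.
  exact: leq_trans ed dk.
apply: IHe => [|j kj|j kj]; first exact: ltnW.
  have [/andP[x0 x1] gap] := de_boor_convex ks kj ed.
  have [/andP[y0 y1] _] := de_boor_convex kt kj ed.
  rewrite (de_boorE _ ks kj ed) (de_boorE _ kt kj ed).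
  have xy : (s - tau j) / (tau (j + e.+1)%N - tau j) <=
            (t - tau j) / (tau (j + e.+1)%N - tau j).
    by rewrite ler_wpM2r ?lerD2r// invr_ge0 subr_ge0 ltW.
  move: x0 x1 y0 y1 xy; set x := (s - _) / _; set y := (t - _) / _ => x0 x1 y0 y1 xy.
  have [mcj mcj'] := mc _ (range _ kj).
  have [kj' _] := pred_range dk ed kj.
  have c1 := cc' _ kj'.
  have c2 : c j <= c' j.
    by apply: cc'; have /andP[/ltnW -> ->] := range _ kj.
  apply: (@le_trans _ _ (c j.-1 + y * (c j - c j.-1))).
    by rewrite lerD2l ler_wpM2r// subr_ge0.
  have -> : c j.-1 + y * (c j - c j.-1) = (1 - y) * c j.-1 + y * c j by ring.
  have -> : c' j.-1 + y * (c' j - c' j.-1) = (1 - y) * c' j.-1 + y * c' j by ring.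
  by rewrite lerD// ler_wpM2l// subr_ge0.
have kj1 : (k - e <= j <= k)%N by case/andP: kj => /ltnW -> ->.
have kj2 : (k - e <= j.-1 <= k)%N.
  case/andP: kj => kj jk; have j0 : (0 < j)%N by exact: leq_ltn_trans kj.
  by apply/andP; split; [rewrite -ltnS prednK|exact: leq_trans (leq_pred _) jk].
have interlace u z : knot_interval k u ->
    (forall i, (k - e.+1 < i <= k)%N -> z i.-1 <= z i) ->
    de_boor tau e z u j.-1 <= de_boor tau e z u j.
  move=> ku mz.
  have [/andP[x0 x1] _] := de_boor_convex ku kj1 ed.
  have [/andP[y0 y1] _] := de_boor_convex ku kj2 ed.
  rewrite (de_boorE _ ku kj1 ed) (de_boorE _ ku kj2 ed).
  move: x0 x1 y0 y1; set x := _ / _; set y := _ / _ => x0 x1 y0 y1.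
  have z1 := mz _ (range _ kj1); have z2 := mz _ (range _ kj2).
  apply: (@le_trans _ _ (z j.-1)); last by rewrite lerDl mulr_ge0// subr_ge0.
  rewrite -[leRHS](subrK (z j.-1.-1)) addrC lerD2r.
  by rewrite -[leRHS]mul1r ler_wpM2r// subr_ge0.
by split; apply: interlace => // i /mc[].
Qed.

Let coef (lam : 'rV[R]_(m + l)) (j : nat) : R :=
  if insub j is Some i then lam ord0 i else 0.

Let coefE lam (i : 'I_(m + l)) : coef lam i = lam ord0 i.
Proof. by rewrite /coef valK. Qed.

Let spline_pieceE lam k t : knot_interval k t ->
  spline l tau lam t = \sum_(j < m + l) coef lam j * bspline_piece tau k d j t.
Proof.
move=> kt; apply: eq_bigr => j _.
by rewrite coefE (bspline_piece_closed kt).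
Qed.

(** Monotone on each closed knot interval, then by gluing. *)
Lemma spline_monotone (lam : 'rV[R]_(m + l)) : monotone_coef lam ->
  nondecreasing01 (spline l tau lam).
Proof.
move=> mlam.
have piece k s t : knot_interval k s -> knot_interval k t -> s <= t ->
    spline l tau lam s <= spline l tau lam t.
  move=> ks kt st; rewrite (spline_pieceE _ ks) (spline_pieceE _ kt).
  have [_ km _] := ks.
  apply: sum_piece_monotone => // j /andP[kj jk]; split;
    have jm := leq_ltn_trans jk km;
    have j'm := leq_ltn_trans (leq_pred j) jm;
    rewrite (coefE lam (Ordinal jm)) (coefE lam (Ordinal j'm));
    by apply: mlam; exact: leq_pred.
suff H i : (d + i.+1 <= m + l)%N -> forall s t, 0 <= s -> s <= t ->
    t <= tau (d + i.+1)%N -> spline l tau lam s <= spline l tau lam t.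
  move=> s t; rewrite !in_itv /= => /andP[s0 _] /andP[_ t1] st.
  by apply: (H m) => //; rewrite addnS -addSn dS addnC// knot_last.
elim: i => [|i IHi] im s t s0 st ti.
  rewrite addn1 in im ti; apply: (piece d) => //; split => //; rewrite knot_first.
    by rewrite s0 (le_trans st).
  by rewrite (le_trans s0).
have im' : (d + i.+1 <= m + l)%N by rewrite addnS in im; exact: ltnW.
have [ti'|ti'] := leP t (tau (d + i.+1)%N); first exact: IHi.
have inI u : tau (d + i.+1)%N <= u -> u <= t -> knot_interval (d + i.+1)%N u.
  move=> iu ut; split; [exact: leq_addr|by rewrite addnS in im|].
  by rewrite iu -addnS (le_trans ut).
have [si|si] := leP s (tau (d + i.+1)%N).
  apply: (@le_trans _ _ (spline l tau lam (tau (d + i.+1)%N))).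
    exact: IHi.
  by apply: (piece (d + i.+1)%N); rewrite ?(ltW ti')//; apply: inI => //; exact: ltW.
by apply: (piece (d + i.+1)%N) => //; apply: inI => //; exact: ltW.
Qed.

Lemma spline_continuous01 (lam : 'rV[R]_(m + l)) : continuous01 (spline l tau lam).
Proof.
have piece k : (d <= k)%N -> (k < m + l)%N ->
    {within `[tau k, tau k.+1], continuous (spline l tau lam)}.
  move=> dk km.
  apply: (@subspace_eq_continuous _ _ _
    (fun t => \sum_(j < m + l) coef lam j * bspline_piece tau k d j t)).
    move=> t; rewrite inE /= in_itv /= => tk.
    by rewrite /from_subspace /= (@spline_pieceE lam k t).
  apply: continuous_subspaceT => t.
  apply: cvg_sumr => j; apply: cvgM; first exact: cvg_cst.
  exact: continuous_bspline_piece.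
suff H i : (d + i.+1 <= m + l)%N ->
    {within `[tau d, tau (d + i.+1)%N], continuous (spline l tau lam)}.
  have := H m; rewrite addnS -addSn dS addnC knot_last knot_first; exact.
elim: i => [|i IHi] im.
  by rewrite addn1 in im *; exact: piece.
have im' : (d + i.+1 <= m + l)%N by rewrite addnS in im; exact: ltnW.
have -> : `[tau d, tau (d + i.+2)%N]%classic =
    `[tau d, tau (d + i.+1)%N]%classic `|`
    `[tau (d + i.+1)%N, tau (d + i.+1).+1]%classic.
  have t1 : tau d <= tau (d + i.+1)%N.
    by rewrite knot_le ?leq_addr// (leq_ltn_trans im').
  have t2 : tau (d + i.+1)%N <= tau (d + i.+2)%N.
    by rewrite knot_le ?leq_add2l// (leq_ltn_trans im).
  apply/seteqP; split => t /=; rewrite !in_itv /= -addnS.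
    move=> /andP[dt tt]; have [h|/ltW h] := leP t (tau (d + i.+1)%N).
      by left; rewrite dt.
    by right; rewrite h.
  by case=> /andP[h1 h2]; rewrite ?h1 ?h2 ?(le_trans h2 t2) ?(le_trans t1 h1).
apply: withinU_continuous; [exact: itv_closed|exact: itv_closed|exact: IHi|].
by apply: piece; [exact: leq_addr|rewrite addnS in im].
Qed.

Lemma knot_step_le i : (i < m + l)%N -> tau i.+1 - tau i <= max_spacing l m tau.
Proof.
move=> im; have [il|il] := ltnP i d.
  have [tl _ _] := knots; rewrite !tl ?subrr; first exact: bigmax_ge_id.
  - by rewrite -dS (leq_trans il).
  - by rewrite -dS ltnS.
have im' : (i - d < m.+1)%N.
  by rewrite ltn_subLR// addnS -addSn dS addnC.
have := @le_bigmax _ _ _ 0 (fun j : 'I_m.+1 => spacing l tau j) (Ordinal im').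
by rewrite /spacing /= -/d subnKC.
Qed.

(** The active coefficients at t belong to at most l consecutive knots on the left
    of t. *)
Lemma spline_local (lam : 'rV[R]_(m + l)) (t a b : R) : t \in `[0, 1] ->
  (forall j : 'I_(m + l), `|t - tau j| <= l%:R * max_spacing l m tau ->
     a <= lam ord0 j <= b) ->
  a <= spline l tau lam t <= b.
Proof.
move=> t01 lamab; have [k kt] := knot_interval_exists t01.
have [dk km /andP[tk kt1]] := kt.
rewrite (spline_pieceE _ kt); apply: sum_piece_bounds => // j /andP[kj jk].
have jm := leq_ltn_trans jk km.
rewrite (coefE lam (Ordinal jm)); apply: lamab => /=.
have jt : tau j <= t by rewrite (le_trans _ tk)// knot_le// (ltn_trans km).
rewrite ger0_norm ?subr_ge0//.
have ms0 : 0 <= max_spacing l m tau by exact: bigmax_ge_id.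
have tel q : (j + q <= m + l)%N -> tau (j + q)%N - tau j <= q%:R * max_spacing l m tau.
  elim: q => [|q IHq] jq; first by rewrite addn0 subrr mul0r.
  rewrite addnS in jq *.
  have -> : tau (j + q).+1 - tau j =
      (tau (j + q).+1 - tau (j + q)%N) + (tau (j + q)%N - tau j).
    by ring.
  rewrite -natr1 mulrDl mul1r addrC lerD ?knot_step_le//.
  exact/IHq/ltnW.
apply: (@le_trans _ _ (tau k.+1 - tau j)); first by rewrite lerD2r.
have kE : (j + (k.+1 - j) = k.+1)%N by rewrite subnKC// leqW.
have := tel (k.+1 - j)%N; rewrite kE => /(_ km) /le_trans; apply.
rewrite ler_wpM2r// ler_nat -dS subSn// ltnS leq_subLR addnC -leq_subLR//.
Qed.

End spline.

Lemma measurable_bspline_deg (R : realType) (tau : nat -> R) (d j : nat) :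
  measurable_fun setT (bspline_deg tau d j).
Proof.
elim: d j => [|d IHd] j /=.
  pose A : set R := `[tau j, tau j.+1[ `|`
    (if (tau j < tau j.+1) && (tau j.+1 == 1) then [set 1] else set0).
  have mA : measurable A.
    apply: measurableU; first exact: measurable_itv.
    by case: ifP => _; [exact: measurable_set1|exact: measurable0].
  rewrite (_ : (fun t => _) = \1_A); first exact: measurable_indic.
  apply/funext => t; rewrite indicE; congr (_%:R); congr nat_of_bool.
  apply/idP/idP.
    move=> /orP[h|/and3P[h1 h2 /eqP ->]]; rewrite inE; [left|right].
      by rewrite /= in_itv.
    by rewrite h1 h2.
  rewrite inE => -[|]; first by rewrite /= in_itv /= => ->.
  by case: ifP => // /andP[-> ->] /= ->; rewrite eqxx orbT.
have aff (a b : R) : measurable_fun setT (fun t : R => (t - a) / b).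
  apply: measurable_funM; last exact: measurable_cst.
  by apply: measurable_funB => //; exact: measurable_cst.
apply: measurable_funD; apply: measurable_funM => //.
apply: measurable_funM; last exact: measurable_cst.
by apply: measurable_funB => //; exact: measurable_cst.
Qed.

Lemma measurable_spline (R : realType) (l k : nat) (tau : nat -> R)
    (lam : 'rV[R]_k) :
  measurable_fun setT (spline l tau lam).
Proof.
apply: measurable_sum => j; apply: measurable_funM; first exact: measurable_cst.
exact: measurable_bspline_deg.
Qed.

(** * Grid approximation *)

Lemma cvg_pair_nbhs (T : Type) (F : set_system T) {FF : Filter F}
    (U V : topologicalType) (f : T -> U) (g : T -> V) (a : U) (b : V) :
  f x @[x --> F] --> a -> g x @[x --> F] --> b -> (f x, g x) @[x --> F] --> (a, b).
Proof. by move=> fa gb; exact: (@cvg_pair _ _ _ F (nbhs a) (nbhs b) _ _ _ f g fa gb). Qed.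

Section grid.
Context (R : realType).

Definition grid (N : nat) (x : R) : R := (Num.floor (N.+1%:R * x))%:~R / N.+1%:R.

Lemma grid_le N x y : x <= y -> grid N x <= grid N y.
Proof.
move=> xy; rewrite /grid ler_wpM2r ?invr_ge0// ler_int.
by apply: le_floor; rewrite ler_wpM2l.
Qed.

Lemma cvg_grid x : grid N x @[N --> \oo] --> x.
Proof.
apply/cvgrPdist_le => e e0.
near=> N; have N0 : 0 < N.+1%:R :> R by [].
have -> : x - grid N x = (N.+1%:R * x - (Num.floor (N.+1%:R * x))%:~R) / N.+1%:R.
  by rewrite /grid; field; rewrite gt_eqF// -natr1 in N0 *.
rewrite normrM [`|_^-1|]gtr0_norm ?invr_gt0// ler_pdivrMr//.
apply: (@le_trans _ _ 1).
  have /andP[h1 h2] := floor_itv (N.+1%:R * x).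
  rewrite ger0_norm ?subr_ge0// lerBlDl ltW//.
  by move: h2; rewrite intrD addrC.
rewrite mulrC -ler_pdivrMr// mul1r; near: N.
exists (Num.truncn e^-1) => // n /= en.
by rewrite (le_trans (ltW (truncnS_gt _)))// ler_nat ltnS.
Unshelve. all: by end_near.
Qed.

(** Continuous functions are limits of functions that only depend on the grid
    approximations of their arguments, which take countably many values. *)
Lemma measurable_continuous2 (d : measure_display) (X : measurableType d)
    (h : R * R -> R) (Y U : X -> R) : continuous h ->
  measurable_fun setT Y -> measurable_fun setT U ->
  measurable_fun setT (fun x => h (Y x, U x)).
Proof.
move=> ch mY mU.
apply: (measurable_fun_cvg (h := fun N x => h (grid N (Y x), grid N (U x)))) => [N|x _].
  have mlevel (V : X -> R) (i : int) : measurable_fun setT V ->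
      measurable [set x : X | Num.floor (N.+1%:R * V x) = i].
    move=> mV.
    have mNV : measurable_fun setT (fun x => N.+1%:R * V x).
      by apply: measurable_funM => //; exact: measurable_cst.
    rewrite (_ : mkset _ = [set x | (i%:~R <= N.+1%:R * V x)%R] `&`
        [set x | (N.+1%:R * V x < (i + 1)%:~R)%R]).
      apply: measurableI.
        rewrite -[X in measurable X]setTI.
        by apply: (measurable_fun_ler (f := cst _)) => //; exact: measurable_cst.
      rewrite -[X in measurable X]setTI.
      by apply: (measurable_fun_ltr (g := cst _)) => //; exact: measurable_cst.
    apply/seteqP; split => x /=; first by move=> <-; exact/andP/floor_itv.
    by move=> /andP; exact: floor_def.
  move=> _ A mA; rewrite setTI.
  rewrite (_ : _ @^-1` A = \bigcup_(q : int * int)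
     (if `[< A (h (q.1%:~R / N.+1%:R, q.2%:~R / N.+1%:R)) >] then
       [set x | Num.floor (N.+1%:R * Y x) = q.1] `&`
       [set x | Num.floor (N.+1%:R * U x) = q.2] else set0)).
    apply: countable_bigcupT_measurable => // q; case: asboolP => // _.
    by apply: measurableI; exact: mlevel.
  apply/seteqP; split => x /=.
    move=> Ax; exists (Num.floor (N.+1%:R * Y x), Num.floor (N.+1%:R * U x)) => //=.
    by case: asboolP.
  by move=> [q _]; case: asboolP => // Aq [/= q1 q2]; rewrite /grid q1 q2.
apply: (@continuous2_cvg _ _ _ _ _ _ _ _ (fun y u => h (y, u))).
- by apply: cvg_trans (ch (Y x, U x)); apply: near_eq_cvg; apply: nearW => -[].
- exact: cvg_grid.
- exact: cvg_grid.
Qed.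

End grid.

(** * Limits of expectations *)

Section bounded_convergence.
Context (R : realType) (d : measure_display) (T : measurableType d).
Variable P : probability T R.

Lemma bounded_measurable_cvg (f_ : nat -> T -> R) (f : T -> R) (M : R) :
  (forall n, measurable_fun setT (f_ n)) -> (forall n x, `|f_ n x| <= M) ->
  (forall x, f_ n x @[n --> \oo] --> f x) -> bounded_measurable f.
Proof.
move=> mf fM ff; split; first by apply: (measurable_fun_cvg mf) => x _; exact: ff.
exists M => x.
apply: (@closed_cvg _ _ _ eventually_filter (fun n => `|f_ n x|) (fun y => y <= M)).
- exact: closed_le.
- by apply: nearW => n; exact: fM.
- by apply: cvg_norm; exact: ff.
Qed.

Lemma expect_cvg (f_ : nat -> T -> R) (f : T -> R) (M : R) :
  (forall n, measurable_fun setT (f_ n)) -> (forall n x, `|f_ n x| <= M) ->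
  (forall x, f_ n x @[n --> \oo] --> f x) ->
  \int[P]_x f_ n x @[n --> \oo] --> \int[P]_x f x.
Proof.
move=> mf fM ff; have bf := bounded_measurable_cvg mf fM ff.
have [] := @dominated_convergence _ _ _ P setT measurableT
  (fun n x => (f_ n x)%:E) (fun x => (f x)%:E) (cst M%:E).
- by move=> n; exact/measurable_EFinP.
- by apply/measurable_EFinP; case: bf.
- by apply: aeW => x _; apply: cvg_EFin; [exact: nearW|exact: ff].
- apply: (@bounded_measurable_integrable _ _ _ P (cst M)).
  exact: bounded_measurable_cst.
- by apply: aeW => x n _; rewrite lee_fin; exact: fM.
move=> _ _ h; apply: fine_cvg.
have <- : (\int[P]_x (f x)%:E)%E = (\int[P]_x f x)%:E.
  exact: bounded_measurable_integralE.
exact: h.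
Qed.

End bounded_convergence.

(** * The loss as a function of its parameters *)

Section loss.
Context (R : realType) (p : nat).
Variables (w : p.-tuple (measurableTypeR R) -> R) (rho : R -> R -> R -> R).
Variable KK : set R.
Hypothesis openKK : open KK.
Hypothesis rho_continuous : {within [set v : R * R * R | KK v.2],
  continuous (fun v : R * R * R => rho v.1.1 v.1.2 v.2)}.

Lemma cvg_rho (y u a : R) (u_ a_ : nat -> R) : KK a ->
  u_ n @[n --> \oo] --> u -> a_ n @[n --> \oo] --> a ->
  rho y (u_ n) (a_ n) @[n --> \oo] --> rho y u a.
Proof.
move=> KKa uu aa.
have openK3 : open [set v : R * R * R | KK v.2].
  by apply: (open_comp (f := snd)) => // v _; exact: cvg_snd.
have := rho_continuous; rewrite (continuous_open_subspace _ openK3).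
move=> /(_ (y, u, a)); rewrite inE => /(_ KKa) c3.
apply: (cvg_comp (fun n => (y, u_ n, a_ n)) _ _ c3).
by apply: cvg_pair_nbhs => //; apply: cvg_pair_nbhs => //; exact: cvg_cst.
Qed.

Lemma measurable_loss (b : 'rV[R]_p) (g : R -> R) (a : R) : KK a ->
  measurable_fun setT w -> measurable_fun setT g ->
  measurable_fun setT (loss rho w b g a).
Proof.
move=> KKa mw mg.
have mx : measurable_fun setT (fun z : obs R p => obs_x z).
  exact: measurableT_comp measurable_snd measurable_fst.
have my : measurable_fun setT (fun z : obs R p => obs_y z).
  exact: measurableT_comp measurable_fst measurable_fst.
have mt : measurable_fun setT (fun z : obs R p => obs_t z) by exact: measurable_snd.
apply: measurable_funM; last exact: measurableT_comp mw mx.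
apply: (measurable_continuous2 (h := fun yu => rho yu.1 yu.2 a)) => //.
  move=> yu.
  have := rho_continuous; rewrite continuous_open_subspace; last first.
    by apply: (open_comp (f := snd)) => // v _; exact: cvg_snd.
  move=> /(_ (yu, a)); rewrite inE => /(_ KKa) c3.
  apply: (cvg_comp (fun v => (v, a)) _ _ c3).
  by apply: cvg_pair_nbhs; [exact: cvg_id|exact: cvg_cst].
apply: measurable_funD; last exact: measurableT_comp mg mt.
apply: measurable_sum => j; apply: measurable_funM; last exact: measurable_cst.
exact: measurableT_comp (measurable_tnth j) mx.
Qed.

Lemma cvg_loss (b : 'rV[R]_p) (b_ : nat -> 'rV[R]_p) (g : R -> R) (g_ : nat -> R -> R)
    (a : R) (a_ : nat -> R) (z : obs R p) : KK a ->
  (forall j, b_ n ord0 j @[n --> \oo] --> b ord0 j) ->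
  g_ n (obs_t z) @[n --> \oo] --> g (obs_t z) ->
  a_ n @[n --> \oo] --> a ->
  loss rho w (b_ n) (g_ n) (a_ n) z @[n --> \oo] --> loss rho w b g a z.
Proof.
move=> KKa bb gg aa; apply: cvgM; last exact: cvg_cst.
apply: cvg_rho => //; apply: cvgD => //.
by apply: cvg_sumr => j; apply: cvgM; [exact: cvg_cst|exact: bb].
Qed.

End loss.

(** * Rates *)

Section rates.
Context (R : realType).

Lemma bigO_powR_sublinear (k : nat -> R) (nu c : R) : 0 < nu < 2^-1 -> 0 < c ->
  k =O_\oo (fun n => n%:R `^ nu) -> \forall n \near \oo, `|k n| <= c * n%:R.
Proof.
move=> /andP[nu0 nu12] c0 /eqO_exP[C C0 kC].
near=> n.
have n1 : 1 <= n%:R :> R by near: n; exact: near_nat_ge.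
have nC : (C / c) ^+ 2 <= n%:R by near: n; exact: near_nat_ge.
have kn : `|k n| <= C * `|n%:R `^ nu| by near: n; exact: kC.
apply: le_trans kn _; rewrite ger0_norm ?powR_ge0//.
have h1 : n%:R `^ nu <= Num.sqrt n%:R.
  by rewrite -powR12_sqrt ?ler0n// ler_powR// ltW.
have h2 : C <= c * Num.sqrt n%:R.
  rewrite mulrC -ler_pdivrMr//.
  rewrite -(ler_sqr (x := C / c)) ?nnegrE ?sqrtr_ge0 ?divr_ge0 ?(ltW C0) ?(ltW c0)//.
  by rewrite sqr_sqrtr.
apply: (@le_trans _ _ (c * Num.sqrt n%:R * Num.sqrt n%:R)).
  by apply: ler_pM => //; exact: ltW.
by rewrite -mulrA -expr2 sqr_sqrtr.
Unshelve. all: by end_near.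
Qed.

Lemma bigO_powRN_cvg0 (s : nat -> R) (nu : R) : 0 < nu ->
  s =O_\oo (fun n => n%:R `^ (- nu)) -> s n @[n --> \oo] --> 0.
Proof.
move=> nu0 /eqO_exP[C C0 sC].
apply/cvgr0Pnorm_le => e e0; near=> n.
have n1 : 1 <= n%:R :> R by near: n; exact: near_nat_ge.
have nC : (C / e) `^ nu^-1 <= n%:R by near: n; exact: near_nat_ge.
have sn : `|s n| <= C * `|n%:R `^ (- nu)| by near: n; exact: sC.
apply: le_trans sn _; rewrite ger0_norm ?powR_ge0// powRN.
have n0 : 0 < n%:R `^ nu by rewrite powR_gt0// (lt_le_trans ltr01).
rewrite ler_pdivrMr// mulrC -ler_pdivrMr//.
have Ce : 0 <= C / e by rewrite divr_ge0// ltW.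
have -> : C / e = ((C / e) `^ nu^-1) `^ nu.
  by rewrite -powRrM mulVf ?gt_eqF// powRr1.
by rewrite ge0_ler_powR ?nnegrE ?powR_ge0 ?ler0n// ltW.
Unshelve. all: by end_near.
Qed.

End rates.

Section covering_subexponential.
Context (R : realType) (p : nat) (d : measure_display) (T : measurableType d).
Variables (P : probability T R) (Z : nat -> T -> obs R p).
Variables (FF : nat -> set (obs R p -> R)) (k : nat -> nat) (nu : R).

(** The number k of parameters is o(n) because nu < 1/2, so the logarithm of
    the covering number is o(n) outside a small event. *)
Lemma covering_subexponential :
  (forall eps : R, 0 < eps < 1 -> bounded_in_probability P
     (fun n omega => lne (covering_number n (Z ^~ omega) eps (FF n)))
     (fun n => (k n)%:R * ln eps^-1)) ->
  0 < nu < 2^-1 -> (fun n => (k n)%:R : R) =O_\oo (fun n => n%:R `^ nu) ->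
  subexponential_covering P Z FF.
Proof.
move=> cover nu12 kO eps gamma delta eps01 gamma0 delta0.
have [K Kcover] := cover _ eps01 _ delta0.
have /andP[eps0 eps1] := eps01.
have leps : 0 < ln eps^-1 by rewrite ln_gt0// invf_gt1.
pose c := gamma / 2 / ((`|K| + 1) * ln eps^-1).
have K1 : 0 < `|K| + 1 by rewrite ltr_wpDl.
have c0 : 0 < c by rewrite !divr_gt0// mulr_gt0.
near=> n.
have kc : `|(k n)%:R : R| <= c * n%:R.
  by near: n; exact: bigO_powR_sublinear nu12 c0 kO.
have n2 : 2 / gamma <= n%:R by near: n; exact: near_nat_ge.
have [B [mB PB nB]] : exists B : set T, [/\ measurable B, (P B < delta%:E)%E &
    [set omega | ((K * ((k n)%:R * ln eps^-1))%:E <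
      `|lne (covering_number n (Z ^~ omega) eps (FF n))|)%E] `<=` B].
  by near: n; exact: Kcover.
exists B; split => //; first exact: ltW.
move=> omega Bomega.
have : (`|lne (covering_number n (Z ^~ omega) eps (FF n))| <=
    (K * ((k n)%:R * ln eps^-1))%:E)%E.
  by rewrite leNgt; apply/negP => h; apply: Bomega; exact: nB.
set cov := covering_number _ _ _ _.
have rate : K * ((k n)%:R * ln eps^-1) <= gamma / 2 * n%:R.
  rewrite ger0_norm ?ler0n// in kc.
  apply: (@le_trans _ _ ((`|K| + 1) * (c * n%:R * ln eps^-1))).
    apply: (@le_trans _ _ ((`|K| + 1) * ((k n)%:R * ln eps^-1))).
      rewrite ler_wpM2r ?mulr_ge0 ?ler0n ?(ltW leps)//.
      by rewrite (le_trans (ler_norm _))// lerDl.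
    by rewrite !(ler_wpM2l, ler_wpM2r) ?(ltW leps) ?(ltW K1).
  rewrite /c le_eqVlt; apply/orP; left; apply/eqP; field.
  by rewrite !gt_eqF.
have big2 : 1 <= gamma / 2 * n%:R.
  move: n2; rewrite ler_pdivrMr// => n2; lra.
move=> lcov.
have [x covE xle] : exists2 x, cov = x%:E & x <= expR (gamma / 2 * n%:R).
  move: lcov; case: cov => [x| |] //=; case: (leP x 0) => [//|x0].
  rewrite lee_fin => /(le_trans (ler_norm _)) lnx; exists x => //.
  by rewrite -[x]lnK ?posrE// ler_expR (le_trans lnx).
have [_ [N [c' cN] <-] Ncov] : exists2 y, [set N%:R%:E | N in [set N : nat |
    exists c : 'I_N -> obs R p -> R, forall f, FF n f ->
      exists j, n%:R^-1 * \sum_(i < n) `|f (Z i omega) - c j (Z i omega)| < eps]] y &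
    (y < cov + 1%:E)%E.
  by apply: lb_ereal_inf_adherent => //; move: covE; rewrite /cov /covering_number => ->.
exists N; last by exists c'.
move: Ncov; rewrite covE -EFinD lte_fin => /ltW /le_trans; apply.
apply: (@le_trans _ _ (expR (gamma / 2 * n%:R) + 1)); first by rewrite lerD2r.
have -> : gamma * n%:R = gamma / 2 * n%:R + gamma / 2 * n%:R by field.
rewrite expRD; set y := gamma / 2 * n%:R in big2 *.
have e2 : 2 <= expR y by apply: le_trans (expR_ge1Dx y); lra.
by nra.
Unshelve. all: by end_near.
Qed.

End covering_subexponential.

(** * Approximation by monotone splines *)

Section interpolant.
Context (R : realType) (l : nat).
Hypothesis l1 : (1 < l)%N.
Variable eta : R -> R.

Definition knot_values (m : nat) (tau : nat -> R) : 'rV[R]_(m + l) :=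
  \row_j eta (tau j).

Lemma monotone_knot_values m tau : knot_seq l m tau -> nondecreasing01 eta ->
  monotone_coef (knot_values m tau).
Proof.
move=> knots meta i j ij; rewrite !mxE; apply: meta.
- exact: (knot_in01 knots l1 (ltn_ord i)).
- exact: (knot_in01 knots l1 (ltn_ord j)).
- apply: (knot_le knots l1 ij); apply: (ltn_trans (ltn_ord j)).
  by rewrite ltn_add2l -addnn -[X in (X < _)%N]addn0 ltn_add2l ltnW.
Qed.

(** Only coefficients eta (tau j) with tau j close to t are active at t, so
    continuity of eta suffices. *)
Lemma cvg_spline_knot_values (m : nat -> nat) (tau : nat -> nat -> R) (t : R) :
  (forall n, (0 < n)%N -> knot_seq l (m n) (tau n)) ->
  max_spacing l (m n) (tau n) @[n --> \oo] --> 0 ->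
  continuous01 eta -> t \in `[0, 1] ->
  spline l (tau n) (knot_values (m n) (tau n)) t @[n --> \oo] --> eta t.
Proof.
move=> knots sp0 ceta t01; apply/cvgrPdist_le => e e0.
have [dl dl0 etad] : exists2 dl, 0 < dl &
    forall s, s \in `[0, 1] -> `|t - s| < dl -> `|eta t - eta s| <= e.
  have t01' : [set` `[0, 1]] t by [].
  have /subspace_continuousP/(_ t t01')/cvgrPdist_le/(_ e e0) := ceta.
  move=> -[dl /= dl0 h].
  by exists dl => // s s01 ts; exact: (h s ts s01).
have dll : 0 < dl / l%:R by rewrite divr_gt0// ltr0n ltnW.
have /cvgrPdist_lt/(_ _ dll) sp_small := sp0.
near=> n.
have n0 : (0 < n)%N by near: n; exists 1%N.
have spn : l%:R * max_spacing l (m n) (tau n) < dl.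
  rewrite mulrC -ltr_pdivlMr ?ltr0n 1?ltnW//.
  rewrite (le_lt_trans (ler_norm _))// -normrN -sub0r.
  by near: n; exact: sp_small.
rewrite distrC ler_distl; apply: (spline_local (knots n n0) l1) => // j tj.
rewrite mxE -ler_distl distrC; apply: etad; last exact: le_lt_trans spn.
exact: (knot_in01 (knots n n0) l1 (ltn_ord j)).
Unshelve. all: by end_near.
Qed.

End interpolant.

(** * Uniform convergence of the empirical risk *)

Section empirical_risk.
Context (R : realType) (p : nat) (d : measure_display) (T : measurableType d).
Variables (P : probability T R) (Z : nat -> T -> obs R p).
Variables (w : p.-tuple (measurableTypeR R) -> R) (rho : R -> R -> R -> R).
Variables (KK VV : set R) (kappa0 Mrho Mw : R).
Variables (l : nat) (m : nat -> nat) (tau : nat -> nat -> R).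
Hypotheses (iidZ : iid P Z) (openKK : open KK) (mw : measurable_fun setT w).
Hypotheses (VVkappa0 : nbhs kappa0 VV) (VK : VV `<=` KK).
Hypothesis rhoM : forall y u a, KK a -> 0 <= rho y u a <= Mrho.
Hypothesis wM : forall x, 0 <= w x <= Mw.
Hypothesis rho_continuous : {within [set v : R * R * R | KK v.2],
  continuous (fun v : R * R * R => rho v.1.1 v.1.2 v.2)}.

Let M : R := Mrho * Mw + 1.

Let Mrho0 : 0 <= Mrho.
Proof.
have /andP[h1 h2] := @rhoM 0 0 kappa0 (VK (nbhs_singleton VVkappa0)).
exact: le_trans h2.
Qed.

Let Mw0 : 0 <= Mw.
Proof. by have /andP[h1 h2] := wM [tuple of nseq p 0]; exact: le_trans h2. Qed.

Let M0 : 0 < M. Proof. by rewrite ltr_wpDl// mulr_ge0. Qed.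

Let loss01 b g a z : KK a -> 0 <= loss rho w b g a z <= M.
Proof.
move=> KKa; have /andP[h1 h2] := rhoM (obs_y z) (dot (obs_x z) b + g (obs_t z)) KKa.
have /andP[h3 h4] := wM (obs_x z).
rewrite /loss mulr_ge0//= (@le_trans _ _ (Mrho * Mw))//; last by rewrite lerDl.
by rewrite ler_pM.
Qed.

Let norm_loss_le b g a z : KK a -> `|loss rho w b g a z| <= M.
Proof. by move=> /(loss01 b g z)/andP[h1 h2]; rewrite ger0_norm. Qed.

Definition loss_class (n : nat) : set (obs R p -> R) :=
  [set f | exists b, exists lam : 'rV[R]_(m n + l), exists a,
    [/\ monotone_coef lam, VV a & f = loss rho w b (spline l (tau n) lam) a]].

Lemma measurable_loss_class n f : loss_class n f -> measurable_0M M f.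
Proof.
move=> [b [lam [a [_ VVa ->]]]]; split; last by move=> z; apply: loss01; exact: VK.
apply: (measurable_loss openKK rho_continuous) => //; first exact: VK.
exact: measurable_spline.
Qed.

Definition mean_loss (b : 'rV[R]_p) (g : R -> R) (a : R) : R :=
  law_mean P Z (loss rho w b g a).

Lemma risk_spline n b (lam : 'rV[R]_(m n + l)) a : KK a ->
  risk P (Z 0%N) rho w b (spline l (tau n) lam) a =
  (mean_loss b (spline l (tau n) lam) a)%:E.
Proof.
move=> KKa; rewrite /risk unlock; apply: bounded_measurable_integralE.
have [mZ _ _] := iidZ.
have mloss := measurable_loss openKK rho_continuous b KKa mw
  (measurable_spline l (tau n) lam).
split; first exact: measurableT_comp mloss (mZ 0%N).
by exists M => omega; exact: norm_loss_le.
Qed.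

(** Along the observations the loss of g is a pointwise limit of losses of splines.
    It inherits measurability from them, although g itself may fail to be
    measurable away from [0, 1]. *)
Lemma cvg_risk (n_ : nat -> nat) (b_ : nat -> 'rV[R]_p)
    (lam_ : forall i, 'rV[R]_(m (n_ i) + l)) (a_ : nat -> R) (b : 'rV[R]_p)
    (g : R -> R) (a : R) :
  (forall i, KK (a_ i)) -> KK a ->
  (forall j, b_ i ord0 j @[i --> \oo] --> b ord0 j) ->
  (forall omega, spline l (tau (n_ i)) (lam_ i) (obs_t (Z 0%N omega)) @[i --> \oo]
     --> g (obs_t (Z 0%N omega))) ->
  a_ i @[i --> \oo] --> a ->
  mean_loss (b_ i) (spline l (tau (n_ i)) (lam_ i)) (a_ i) @[i --> \oo] --> mean_loss b g a
  /\ risk P (Z 0%N) rho w b g a = (mean_loss b g a)%:E.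
Proof.
move=> KKa_ KKa bb gg aa; have [mZ _ _] := iidZ.
have mf i : measurable_fun setT
    (fun omega => loss rho w (b_ i) (spline l (tau (n_ i)) (lam_ i)) (a_ i) (Z 0%N omega)).
  have mloss := measurable_loss openKK rho_continuous (b_ i) (KKa_ i) mw
    (measurable_spline l (tau (n_ i)) (lam_ i)).
  exact: measurableT_comp mloss (mZ 0%N).
have fM i omega : `|loss rho w (b_ i) (spline l (tau (n_ i)) (lam_ i)) (a_ i)
    (Z 0%N omega)| <= M by exact: norm_loss_le.
have ff omega : loss rho w (b_ i) (spline l (tau (n_ i)) (lam_ i)) (a_ i)
    (Z 0%N omega) @[i --> \oo] --> loss rho w b g a (Z 0%N omega).
  exact: (cvg_loss openKK rho_continuous KKa bb (gg omega) aa).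
split; first exact: (expect_cvg mf fM ff).
rewrite /risk unlock; apply: bounded_measurable_integralE.
exact: bounded_measurable_cvg mf fM ff.
Qed.

Let scaled N q (v : 'rV[int]_q) : 'rV[R]_q := map_mx (fun i => i%:~R / N.+1%:R) v.

Let floors N q (v : 'rV[R]_q) : 'rV[int]_q :=
  map_mx (fun x => Num.floor (N.+1%:R * x)) v.

Let scaled_floors N q (v : 'rV[R]_q) j : scaled N (floors N v) ord0 j = grid N (v ord0 j).
Proof. by rewrite !mxE. Qed.

(** A countable dense subfamily: rational parameters, with a fixed member for the
    invalid codes.  Rounding down to a grid preserves the monotonicity of
    coefficients. *)
Let grid_loss n (i : nat) : obs R p -> R :=
  let default := loss rho w 0 (spline l (tau n) (0 : 'rV[R]_(m n + l))) kappa0 in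
  if (unpickle i : option (nat * 'rV[int]_p * 'rV[int]_(m n + l) * int)) is
    Some (N, b, lam, a) then
    if `[< monotone_coef (scaled N lam) /\ VV (a%:~R / N.+1%:R) >] then
      loss rho w (scaled N b) (spline l (tau n) (scaled N lam)) (a%:~R / N.+1%:R)
    else default
  else default.

Let grid_loss_class n i : loss_class n (grid_loss n i).
Proof.
have default : loss_class n
    (loss rho w 0 (spline l (tau n) (0 : 'rV[R]_(m n + l))) kappa0).
  exists 0, 0, kappa0; split => //; last exact: nbhs_singleton.
  by move=> j k _; rewrite !mxE.
rewrite /grid_loss; case: unpickle => [[[[N b] lam] a]|//].
case: asboolP => // -[mlam VVa].
by exists (scaled N b), (scaled N lam), (a%:~R / N.+1%:R).
Qed.

Let grid_loss_dense n b (lam : 'rV[R]_(m n + l)) a : monotone_coef lam -> nbhs a VV ->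
  exists i_ : nat -> nat, forall z, grid_loss n (i_ N) z @[N --> \oo] -->
    loss rho w b (spline l (tau n) lam) a z.
Proof.
move=> mlam VVa.
exists (fun N => pickle (N, floors N b, floors N lam, Num.floor (N.+1%:R * a))) => z.
have KKa : KK a by apply: VK; exact: nbhs_singleton.
have gridVV : \forall N \near \oo, VV (grid N a) by exact: (@cvg_grid R a VV VVa).
apply: (@cvg_trans _ (loss rho w (scaled N (floors N b))
    (spline l (tau n) (scaled N (floors N lam))) (grid N a) z @[N --> \oo])).
  apply: near_eq_cvg; near=> N.
  rewrite /grid_loss pickleK; case: asboolP => // -[]; split; last by near: N.
  by move=> i j ij; rewrite !scaled_floors; apply: grid_le; exact: mlam.
apply: (cvg_loss openKK rho_continuous) => //; last exact: cvg_grid.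
  by move=> j; under eq_fun do rewrite scaled_floors; exact: cvg_grid.
apply: cvg_sumr => j; apply: cvgM; last exact: cvg_cst.
by under eq_fun do rewrite scaled_floors; exact: cvg_grid.
Unshelve. all: by end_near.
Qed.

Hypothesis cover : subexponential_covering P Z loss_class.

(** The uniform law holds on the countable subfamily, and both the empirical and
    the exact risk are limits along it. *)
Lemma ae_uniform_empirical_risk : {ae P, forall omega, forall eps : R, 0 < eps ->
  \forall n \near \oo, forall b (lam : 'rV[R]_(m n + l)) a, monotone_coef lam ->
    nbhs a VV ->
    `|emp_risk rho w n (Z ^~ omega) b (spline l (tau n) lam) a
      - mean_loss b (spline l (tau n) lam) a| <= eps}.
Proof.
have := @ae_uniform_law R _ _ T _ P Z M iidZ M0 loss_class measurable_loss_class cover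
  grid_loss grid_loss_class.
apply: filterS => omega uniform eps eps0.
apply: filterS (uniform eps eps0) => n {}uniform b lam a mlam VVa.
have [i_ ilim] := grid_loss_dense b mlam VVa.
have [mZ _ _] := iidZ.
apply: (@closed_cvg _ _ _ eventually_filter (fun N =>
    `|n%:R^-1 * \sum_(i < n) grid_loss n (i_ N) (Z i omega)
      - law_mean P Z (grid_loss n (i_ N))|) (fun y => y <= eps)).
- exact: closed_le.
- by apply: nearW => N; exact: uniform.
- apply: cvg_norm; apply: cvgB.
    apply: cvgM; first exact: cvg_cst.
    by apply: cvg_sumr => i; exact: ilim.
  apply: (expect_cvg (M := M)) => [N|N o|o]; last exact: ilim.
    have [mg _] := measurable_loss_class (grid_loss_class n (i_ N)).
    exact: measurableT_comp mg (mZ 0%N).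
  have [_ /(_ (Z 0%N o))/andP[h1 h2]] := measurable_loss_class (grid_loss_class n (i_ N)).
  by rewrite ger0_norm.
Qed.

End empirical_risk.

(** * Consistency *)

Lemma pi_dist_sym (R : realType) (p : nat) (N : (R -> R) -> R)
    (th1 th2 : 'rV[R]_p * (R -> R)) :
  norm_on_C01 N -> continuous01 th1.2 -> continuous01 th2.2 ->
  pi_dist N th1 th2 = pi_dist N th2 th1.
Proof.
move=> normN c1 c2; rewrite /pi_dist; congr (Num.sqrt (_ ^+ 2 + _ ^+ 2)).
  congr Num.sqrt; apply: eq_bigr => j _.
  by rewrite !mxE -sqrrN opprB.
have c21 : continuous01 (fun t => th2.2 t - th1.2 t).
  by move=> t; apply: cvgB; [exact: c2|exact: c1].
have := normC01_scale normN (-1) c21; rewrite normrN1 mul1r => <-.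
by apply: (normC01_ext normN) => t _; rewrite mulN1r opprB.
Qed.

Lemma lt_ereal_inf_margin (R : realType) (x : R) (A : set (\bar R)) :
  (x%:E < ereal_inf A)%E ->
  exists2 delta : R, 0 < delta & forall y, A y -> ((x + delta)%:E < y)%E.
Proof.
case E : (ereal_inf A) => [r| |] //.
  rewrite lte_fin => xr; exists ((r - x) / 2); first by rewrite divr_gt0// subr_gt0.
  move=> y Ay; apply: (@lt_le_trans _ _ r%:E); first by rewrite lte_fin; lra.
  by rewrite -E; exact: ereal_inf_lbound.
move=> _; exists 1 => // y Ay; apply: (@lt_le_trans _ _ +oo%E); first exact: ltry.
by rewrite -E; exact: ereal_inf_lbound.
Qed.

Theorem theorem3p1 (R : realType) (d : measure_display) (T : measurableType d)
    (P : probability T R) (p : nat)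
    (* model *)
    (Z : nat -> T -> obs R p)
    (F : R -> R.-pker (measurableTypeR R) ~> (measurableTypeR R))
    (H Hinv Afun Vfun : R -> R)
    (beta0 : 'rV[R]_p) (eta0 : R -> R) (KK : set R) (kappa0 : R)
    (* objective function *)
    (w : p.-tuple (measurableTypeR R) -> R) (rho : R -> R -> R -> R)
    (* splines *)
    (l : nat) (m : nat -> nat) (tau : nat -> nat -> R)
    (* estimators *)
    (kappahat : nat -> T -> R) (betahat : nat -> T -> 'rV[R]_p)
    (lamhat : forall n, T -> 'rV[R]_(m n + l))
    (* norm on C[0, 1], neighbourhood of kappa0, rates *)
    (normF : (R -> R) -> R) (VV : set R) (r : nat) (C1 C2 nu : R) :
  let L := risk P (Z 0%N) rho w in
  let sp n (lam : 'rV[R]_(m n + l)) := spline l (tau n) lam in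
  let theta0 := (beta0, eta0) in
  let thetahat n omega := (betahat n omega, sp n (lamhat n omega)) in
  (* the data and the model *)
  iid P Z ->
  open KK -> KK kappa0 ->
  measurable_fun setT H -> cancel H Hinv ->
  continuous01 eta0 -> nondecreasing01 eta0 ->
  (forall i, gplm P (Z i) F H Afun Vfun beta0 eta0 kappa0) ->
  measurable_fun setT w ->
  (* Fisher-consistency *)
  (forall b g, nondecreasing01 g -> ~ (b = beta0 /\ eq01 g eta0) ->
     (L beta0 eta0 kappa0 < L b g kappa0)%E) ->
  (* order and knots of the splines *)
  (1 < l)%N ->
  (forall n, (0 < n)%N -> knot_seq l (m n) (tau n)) ->
  (* the estimators *)
  (forall n omega, KK (kappahat n omega)) ->
  (forall n omega, (0 < n)%N ->
     monotone_coef (lamhat n omega) /\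
     forall b (lam : 'rV[R]_(m n + l)), monotone_coef lam ->
       emp_risk rho w n (Z ^~ omega) (betahat n omega) (sp n (lamhat n omega))
         (kappahat n omega)
       <= emp_risk rho w n (Z ^~ omega) b (sp n lam) (kappahat n omega)) ->
  (* the metric *)
  norm_on_C01 normF ->
  (* VV *)
  nbhs kappa0 VV -> closure VV `<` KK ->
  (* (C0) *)
  {ae P, forall omega, (kappahat ^~ omega) @ \oo --> kappa0} ->
  (* (C1) *)
  (exists M : R, forall y u a, KK a -> 0 <= rho y u a <= M) ->
  (exists M : R, forall x, 0 <= w x <= M) ->
  {within [set v : R * R * R | KK v.2],
     continuous (fun v : R * R * R => rho v.1.1 v.1.2 v.2)} ->
  (forall eps : R, 0 < eps -> exists2 delta : R, 0 < delta &
     forall n, (0 < n)%N -> forall a1 a2, closure VV a1 -> closure VV a2 ->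
       `|a1 - a2| < delta ->
       (ereal_sup [set `|L bl.1 (sp n bl.2) a1 - L bl.1 (sp n bl.2) a2|%E |
          bl in [set bl : 'rV[R]_p * 'rV[R]_(m n + l) | monotone_coef bl.2]]
        < eps%:E)%E) ->
  (* (C2); eta0 is nondecreasing by a previous hypothesis *)
  (1 <= r)%N -> holder_class r C1 C2 eta0 ->
  (* (C3) *)
  0 < nu < 2^-1 ->
  (fun n => max_spacing l (m n) (tau n)) =O_\oo (fun n => n%:R `^ (- nu)) ->
  (exists M : R, forall n, (0 < n)%N ->
     max_spacing l (m n) (tau n) / min_spacing l (m n) (tau n) <= M) ->
  (* (C4) *)
  (forall eps : R, 0 < eps < 1 ->
     bounded_in_probability P
       (fun n omega => lne (covering_number n (Z ^~ omega) eps
          [set f | exists b, exists lam : 'rV[R]_(m n + l), exists a,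
             [/\ monotone_coef lam, VV a & f = loss rho w b (sp n lam) a]]))
       (fun n => (m n + l)%:R * ln eps^-1)) ->
  (* identifiability and rate of k_n *)
  (forall eps : R, 0 < eps ->
     (L beta0 eta0 kappa0 <
      ereal_inf [set L th.1 th.2 kappa0 | th in
        [set th : 'rV[R]_p * (R -> R) |
          [/\ nondecreasing01 th.2, continuous01 th.2 &
              (eps < pi_dist normF th theta0)%R]]])%E) ->
  (fun n => (m n + l)%:R : R) =O_\oo (fun n => n%:R `^ nu) ->
  (2 * r + 2)%:R^-1 < nu < (2 * r)%:R^-1 ->
  (* conclusion *)
  {ae P, forall omega,
     (fun n => pi_dist normF theta0 (thetahat n omega)) @ \oo --> (0 : R)}.
Proof.
move=> L sp theta0 thetahat iidZ openKK KKk _ _ ceta meta model mw _ l1 knots KKhat argmin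
  normF_norm VVk clVK kappa_cvg [Mrho rhoM] [Mw wM] rhoc c1 _ _ nu12 spO _ c4 ident kO _.
have VK : VV `<=` KK by have [clK _] := clVK; apply: subset_trans clK; exact: subset_closure.
have cover : subexponential_covering P Z (@loss_class R p w rho VV l m tau).
  exact: (covering_subexponential c4 nu12 kO).
have := ae_uniform_empirical_risk iidZ openKK mw VVk VK rhoM wM rhoc cover.
have sp0 : max_spacing l (m n) (tau n) @[n --> \oo] --> 0.
  by case/andP: nu12 => nu0 _; exact: bigO_powRN_cvg0 spO.
have t01 omega : obs_t (Z 0%N omega) \in `[0, 1] by exact: (gplm_t01 (model 0%N)).
pose risk_ := mean_loss P Z w rho.
pose lam0 n := knot_values l eta0 (m n) (tau n).
have [lim0 L0E] : risk_ beta0 (sp n (lam0 n)) kappa0 @[n --> \oo] --> risk_ beta0 eta0 kappa0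
    /\ L beta0 eta0 kappa0 = (risk_ beta0 eta0 kappa0)%:E.
  apply: (cvg_risk (n_ := id) (lam_ := lam0) (b_ := fun=> beta0) (a_ := fun=> kappa0)
    iidZ openKK mw rhoM wM rhoc) => //.
  - by move=> j; exact: cvg_cst.
  - by move=> omega; exact: cvg_spline_knot_values.
  - exact: cvg_cst.
have LE n b lam a : KK a -> L b (sp n lam) a = (risk_ b (sp n lam) a)%:E.
  exact: (risk_spline tau iidZ openKK mw rhoM wM rhoc).
move: kappa_cvg; apply: filterS2 => omega kappa_cvg uniform.
apply/cvgrPdist_le => e e0; rewrite /=.
have := ident e e0; rewrite L0E => /lt_ereal_inf_margin[delta delta0 gap].
have delta5 : 0 < delta / 5 by rewrite divr_gt0.
have [dk dk0 c1d] := c1 _ delta5.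
have /cvgrPdist_lt/(_ _ dk0) kappa_near := kappa_cvg.
have /cvgrPdist_le/(_ _ delta5) risk_near := lim0.
have unif := uniform _ delta5.
have VVnear : \forall n \near \oo, nbhs (kappahat n omega) VV.
  exact: (kappa_cvg _ (nbhs_interior VVk)).
near=> n.
have n0 : (0 < n)%N by near: n; exists 1%N.
have VVhat : nbhs (kappahat n omega) VV by near: n; exact: VVnear.
have [mlamhat minimal] := argmin n omega n0.
have mlam0 : monotone_coef (lam0 n) by exact: (monotone_knot_values l1 (knots n n0) meta).
(* Five errors of delta / 5 each: two changes of the nuisance parameter, two
   deviations of the empirical risk, one spline approximation of eta0. *)
have emp_close b (lam : 'rV[R]_(m n + l)) : monotone_coef lam ->
    `|emp_risk rho w n (Z ^~ omega) b (sp n lam) (kappahat n omega)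
      - risk_ b (sp n lam) (kappahat n omega)| <= delta / 5.
  move=> mlam; move: b lam (kappahat n omega) mlam VVhat.
  by near: n; exact: unif.
have kappa_close b (lam : 'rV[R]_(m n + l)) : monotone_coef lam ->
    `|risk_ b (sp n lam) (kappahat n omega) - risk_ b (sp n lam) kappa0| <= delta / 5.
  move=> mlam.
  have hdk : `|kappahat n omega - kappa0| < dk.
    by rewrite distrC; near: n; exact: kappa_near.
  have := c1d n n0 (kappahat n omega) kappa0
    (subset_closure (nbhs_singleton VVhat)) (subset_closure (nbhs_singleton VVk)) hdk.
  move=> /(le_lt_trans _) h.
  rewrite -lee_fin; apply/ltW/h.
  by apply: ereal_sup_ubound; exists (b, lam) => //=; rewrite !LE.
have h1 := kappa_close (betahat n omega) _ mlamhat.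
have h2 := emp_close (betahat n omega) _ mlamhat.
have h3 := minimal beta0 (lam0 n) mlam0.
have h4 := emp_close beta0 _ mlam0.
have h5 := kappa_close beta0 _ mlam0.
have h6 : `|risk_ beta0 eta0 kappa0 - risk_ beta0 (sp n (lam0 n)) kappa0| <= delta / 5.
  by near: n; exact: risk_near.
have chat : continuous01 (sp n (lamhat n omega)) by exact: spline_continuous01 (knots n n0) l1 _.
rewrite sub0r normrN ger0_norm ?sqrtr_ge0// leNgt; apply/negP => far.
have : ((risk_ beta0 eta0 kappa0 + delta)%:E <
    L (betahat n omega) (sp n (lamhat n omega)) kappa0)%E.
  apply: gap; exists (thetahat n omega) => //; split => //=.
    exact: (spline_monotone (knots n n0) l1).
  by rewrite pi_dist_sym.
rewrite LE// lte_fin => far'.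
move: h1 h2 h4 h5 h6; rewrite !ler_norml.
move=> /andP[? ?] /andP[? ?] /andP[? ?] /andP[? ?] /andP[? ?].
lra.
Unshelve. all: by end_near.
Qed.
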